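(* Let $D=\{z\in\mathbb{C}^n:|z|<1\}$, let $\mathcal{F}$ be a family of holomorphic functions $f:D\to\mathbb{C}$, and let $s>0$ be any real number. If the family $$\mathcal{G}=\left\{\frac{|Df(z)|}{1+|f(z)|^s}: f\in\mathcal{F}\right\}$$ is locally uniformly bounded in $D$, then $\mathcal{F}$ is normal on $D$.
   Context: $|\cdot|$ is the Euclidean norm on $\mathbb{C}^n$. For a holomorphic function $f$, $Df=\left(\frac{\partial f}{\partial z_1},\dots,\frac{\partial f}{\partial z_n}\right)$ and $|Df(z)|$ is the Euclidean norm of this vector. $\mathcal{G}$ is locally uniformly bounded in $D$ if for each compact $K\subset D$ there is a constant $M(K)>0$ with $\frac{|Df(z)|}{1+|f(z)|^s}\le M(K)$ for all $z\in K$ and all $f\in\mathcal{F}$. A family $\mathcal{F}$ of holomorphic functions $f:D\to\mathbb{C}$ on a domain $D\subseteq\mathbb{C}^n$ is normal on $D$ if every sequence in $\mathcal{F}$ contains a subsequence that converges locally uniformly on $D$ to a limit function which is either holomorphic on $D$ or identically equal to $\infty$. *)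

(* Defs.v *)
From HB Require Import structures.
From mathcomp Require Import all_boot all_order all_algebra complex.
From mathcomp Require Import all_classical all_reals all_analysis.

Set Implicit Arguments.
Unset Strict Implicit.
Unset Printing Implicit Defensive.

Import Order.TTheory GRing.Theory Num.Theory.
Import numFieldNormedType.Exports.

Local Open Scope classical_set_scope.
Local Open Scope ring_scope.
Local Open Scope complex_scope.

(* MathComp-Analysis puts the topology of the norm on every abstract
   [numFieldType] and on [R[i]^o], but not on the concrete type [R[i]]; these
   instances transport it, so that [R[i]] is a normed space over itself. *)
#[non_forgetful_inheritance]
HB.instance Definition _ (R : rcfType) := GRing.ComAlgebra.copy R[i] R[i]^o.
#[non_forgetful_inheritance]
HB.instance Definition _ (R : rcfType) := Vector.copy R[i] R[i]^o.
#[non_forgetful_inheritance]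
HB.instance Definition _ (R : rcfType) := NormedModule.copy R[i] R[i]^o.

Section NormalFamilies.
Context {R : realType} {n : nat}.
Local Notation C := R[i].
Local Notation Cn := 'rV[R[i]]_n.
Implicit Types (D : set Cn) (f g : Cn -> C) (F : set (Cn -> C)).

(* The modulus in [R]: the norm [`|c|] of [R[i]] is itself [R[i]]-valued. *)
Definition cmod (c : C) : R := complex.Re `|c|.

(* The library norm on ['rV_n] is the sup norm; it gives the same topology. *)
Definition enorm (z : Cn) : R := Num.sqrt (\sum_(i < n) cmod (z 0 i) ^+ 2).

Definition unit_ball : set Cn := [set z | enorm z < 1].

(* Differentiability is over the scalar field [R[i]], i.e. complex.  A function
   D -> C is represented by a total function whose values off D are ignored. *)
Definition holomorphic D f := forall z, D z -> differentiable f z.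

Definition cgrad f (z : Cn) : Cn := \row_(i < n) 'D_(delta_mx 0 i) f z.

Definition locally_uniformly_bounded D (G : set (Cn -> R)) :=
  forall K : set Cn, compact K -> K `<=` D ->
    exists2 M : R, 0 < M & forall h z, G h -> K z -> h z <= M.

Definition cvg_locally_uniformly D (u : nat -> Cn -> C) g :=
  forall z, D z -> exists2 U, nbhs z U & {uniform U `&` D, u @ \oo --> g}.

Definition dvg_locally_uniformly D (u : nat -> Cn -> C) :=
  forall z, D z -> exists2 U, nbhs z U &
    forall A : R, \forall k \near \oo,
      forall w, (U `&` D) w -> A < cmod (u k w).

Definition normal_family D F :=
  forall u : nat -> Cn -> C, (forall k, F (u k)) ->
    exists2 phi : nat -> nat, {homo phi : j k / (j < k)%N} &
      (exists2 g, holomorphic D g & cvg_locally_uniformly D (u \o phi) g) \/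
      dvg_locally_uniformly D (u \o phi).

End NormalFamilies.

(* Main.v *)
Require Import Defs.
From mathcomp Require Import all_boot all_order all_algebra complex.
From mathcomp Require Import all_classical all_reals all_analysis.
From mathcomp Require Import ring lra.
Import Order.TTheory GRing.Theory Num.Theory.
Import numFieldNormedType.Exports.
Local Open Scope classical_set_scope.
Local Open Scope ring_scope.
Local Open Scope complex_scope.

(** The derivative bound gives a local dichotomy, uniform in the family: if
    [2 p >= s], the function [(1 + |f|^2)^-p] is Lipschitz with a constant that
    does not depend on [f], so on a small ball either [|f|] is bounded by a fixed
    constant or [|f| >= 1].  In the second case [ln |f|] is a nonnegative harmonic
    function on complex lines, and Harnack's inequality compares its values.
    Either way [|f w|] is bounded in terms of [|f w'|] for nearby [w, w'], and by
    connectedness a sequence of the family either tends to infinity locally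
    uniformly or has a subsequence bounded at the origin, hence locally bounded.
    In the latter case the derivative bound makes the subsequence locally
    equi-Lipschitz; its limit along an ultrafilter is then locally uniform, and it
    is holomorphic by a uniform second order Taylor estimate.

    All the complex analysis comes from the mean value property on circles,
    obtained by differentiating circle averages under the integral sign; only the
    local boundedness of the derivative is used, not its continuity. *)

(** For [s <= 2] the hypothesis bounds the spherical derivative and Marty's criterion would apply.
    For larger [s] it says little where [|f|] is large, so spherical equicontinuity cannot be read
    off from it. All that is extracted there is [|f| >= 1] on a ball of a size independent of [f];
    this is what makes [ln |f|] nonnegative and opens the way to Harnack. The constant in Harnack's
    inequality is absolute. Each single [f] may therefore be taken bounded on a small ball, by
    compactness and with a bound depending on [f], without spoiling uniformity over the family. The
    comparison is symmetric in the two points: read forwards it spreads boundedness from the origin,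
    and read contrapositively it spreads divergence. The ultrafilter yields limits of the values at
    all points and of all partial derivatives at once, in place of a diagonal argument over a dense
    set. A genuine subsequence is extracted only at the end, from countably many members of the
    ultrafilter given by a compact exhaustion. *)

Set Implicit Arguments.
Unset Strict Implicit.
Unset Printing Implicit Defensive.

(** * Complex moduli and real norms *)

Section RealNorm.
Context {R : realType} {V : normedModType R[i]}.
Implicit Types (u v w : V).

Definition rnorm v : R := complex.Re `|v|.

Lemma rnormE v : `|v| = (rnorm v)%:C.
Proof.
rewrite /rnorm; have := ger0_Im (normr_ge0 v).
by case: `|v| => a b /= ->.
Qed.

Lemma rnorm_ge0 v : 0 <= rnorm v.
Proof. by rewrite -ler0c -rnormE. Qed.

Lemma rnorm0 : rnorm 0 = 0.
Proof. by rewrite /rnorm normr0. Qed.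

Lemma rnorm_eq0 v : (rnorm v == 0) = (v == 0).
Proof.
by rewrite -[RHS]normr_eq0 rnormE; apply/eqP/eqP => [->//|[]].
Qed.

Lemma rnorm_gt0 v : (0 < rnorm v) = (v != 0).
Proof. by rewrite lt_def rnorm_ge0 andbT rnorm_eq0. Qed.

Lemma rnormN v : rnorm (- v) = rnorm v.
Proof. by rewrite /rnorm normrN. Qed.

Lemma rnormB u v : rnorm (u - v) = rnorm (v - u).
Proof. by rewrite -rnormN opprB. Qed.

Lemma rnormD u v : rnorm (u + v) <= rnorm u + rnorm v.
Proof. by rewrite -lecR rmorphD /= -!rnormE ler_normD. Qed.

Lemma rnormZ (a : R[i]) v : rnorm (a *: v) = cmod a * rnorm v.
Proof.
apply: complexI; rewrite rmorphM /= -!rnormE normrZ; congr (_ * _).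
Qed.

Lemma nbhs_rnormP v (A : set V) :
  nbhs v A <-> exists2 e : R, 0 < e & forall w, rnorm (w - v) < e -> A w.
Proof.
split.
  move=> /nbhs_normP[e /= e0 H]; exists (complex.Re e).
    by move: e0; rewrite ltcE => /andP[].
  move=> w wv; apply: H; rewrite /= -normrN opprB rnormE ltcE /= wv andbT.
  by move: e0; rewrite ltcE => /andP[].
case=> e e0 H; apply/nbhs_normP; exists e%:C; first by rewrite /= ltcR.
by move=> w /= ; rewrite -normrN opprB rnormE ltcR => /H.
Qed.

End RealNorm.

Section Cmod.
Context {R : realType}.
Local Notation C := R[i].
Implicit Types (z w : C).

Lemma cmod_ge0 z : 0 <= cmod z.
Proof. exact: (@rnorm_ge0 R C). Qed.

Lemma cmod0 : cmod (0 : C) = 0.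
Proof. exact: (@rnorm0 R C). Qed.

Lemma cmod_eq0 z : (cmod z == 0) = (z == 0).
Proof. exact: (@rnorm_eq0 R C). Qed.

Lemma cmodN z : cmod (- z) = cmod z.
Proof. exact: (@rnormN R C). Qed.

Lemma cmodB z w : cmod (z - w) = cmod (w - z).
Proof. exact: (@rnormB R C). Qed.

Lemma cmodD z w : cmod (z + w) <= cmod z + cmod w.
Proof. exact: (@rnormD R C). Qed.

Lemma norm_cmod z : `|z| = (cmod z)%:C.
Proof. exact: rnormE. Qed.

Lemma cmodM z w : cmod (z * w) = cmod z * cmod w.
Proof. exact: (@rnormZ R C z w). Qed.

Lemma cmodV z : cmod z^-1 = (cmod z)^-1.
Proof. by apply: complexI; rewrite fmorphV /= -!norm_cmod normfV. Qed.

Lemma cmod_real (x : R) : cmod x%:C = `|x|.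
Proof. by rewrite /cmod normc_def /= expr0n addr0 sqrtr_sqr. Qed.

Lemma cmod1 : cmod (1 : C) = 1.
Proof. by rewrite -[1]/(1%:C) cmod_real normr1. Qed.

Lemma cmod_sqr z : cmod z ^+ 2 = complex.Re z ^+ 2 + complex.Im z ^+ 2.
Proof.
by rewrite /cmod normc_def /= sqr_sqrtr // addr_ge0 ?sqr_ge0.
Qed.

Lemma Re_le_cmod z : complex.Re z <= cmod z.
Proof.
by rewrite /cmod normc_def /= (le_trans (ler_norm _)) // -sqrtr_sqr ler_sqrt
  ?lerDl ?addr_ge0 ?sqr_ge0.
Qed.

Lemma normRe_le_cmod z : `|complex.Re z| <= cmod z.
Proof.
rewrite ler_norml Re_le_cmod andbT lerNl.
by have := Re_le_cmod (- z); rewrite cmodN raddfN.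
Qed.

Lemma cmodi : cmod ('i : C) = 1.
Proof. by rewrite /cmod normc_def /= expr0n expr1n add0r sqrtr1. Qed.

Lemma normIm_le_cmod z : `|complex.Im z| <= cmod z.
Proof.
by have := normRe_le_cmod (z * 'i); rewrite ReiNIm normrN cmodM cmodi mulr1.
Qed.

Lemma cmod_le_ReIm z : cmod z <= `|complex.Re z| + `|complex.Im z|.
Proof.
rewrite -(ler_pXn2r (n := 2)) ?nnegrE ?addr_ge0 ?cmod_ge0 //.
rewrite cmod_sqr sqrrD !real_normK ?num_real // -addrA addrC -subr_ge0.
rewrite (_ : _ - _ = `|complex.Re z| * `|complex.Im z| *+ 2); last by ring.
by rewrite mulrn_wge0 // mulr_ge0.
Qed.

(* Reduces bounds on moduli to bounds on real parts. *)
Lemma cmod_Re_rot z : exists2 c : C, cmod c = 1 & cmod z = complex.Re (c * z).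
Proof.
have [->|z0] := eqVneq z 0.
  by exists 1; rewrite ?cmod1 // mulr0 cmod0.
exists (`|z| / z).
  rewrite cmodM cmodV norm_cmod cmod_real ger0_norm ?cmod_ge0 // divff //.
  by rewrite cmod_eq0.
by rewrite divfK // norm_cmod.
Qed.

End Cmod.

(** * The chain rule along real curves *)

Section ComplexDerivative.
Context {R : realType}.
Local Notation C := R[i].
Implicit Types (f : C -> C) (z w a : C).

Lemma is_derive_quotient f z a : is_derive z (1 : C) f a ->
  forall e : R, 0 < e -> exists2 d : R, 0 < d & forall w, w != z ->
    cmod (w - z) < d -> cmod ((f w - f z) / (w - z) - a) <= e.
Proof.
case=> df <- e e0.
have /cvgrPdist_le/(_ e%:C) : (h^-1 *: ((f \o shift z) (h *: (1 : C)) - f z)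
  @[h --> (0 : C)^'] --> 'D_1 f z) by exact: df.
rewrite ltcR => /(_ e0); rewrite near_withinE => /nbhs_rnormP[d d0 H].
exists d => // w wz wd; have := H (w - z).
rewrite subr0 => /(_ wd); rewrite subr_eq0 => /(_ wz) /=.
rewrite norm_cmod lecR; apply: le_trans.
by rewrite -[leLHS]cmodN opprB -[_ *: 1]/(_ * 1) mulr1 subrK [_^-1 *: _]mulrC.
Qed.

(** The outer derivative is over [R[i]] and the inner one over [R]. The curve therefore enters
    through its two real coordinates, and the proof handles only real difference quotients. *)
Lemma is_derive_Re_comp f (g : R -> C) (t : R) (a b : C) :
  is_derive (g t) (1 : C) f a ->
  is_derive t 1 (fun x => complex.Re (g x)) (complex.Re b) ->
  is_derive t 1 (fun x => complex.Im (g x)) (complex.Im b) ->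
  is_derive t 1 (fun x => complex.Re (f (g x))) (complex.Re (a * b)).
Proof.
move=> /is_derive_quotient fQ [dg1 dg1E] [dg2 dg2E].
(* The difference quotient filled in at [g t]: the factorization of [f w - f (g t)] then holds also
   at parameters [x] with [g x = g t]. *)
pose Q w := if w == g t then a else (f w - f (g t)) / (w - g t).
have QE w : f w - f (g t) = Q w * (w - g t).
  rewrite /Q; case: eqP => [->|/eqP wg]; first by rewrite !subrr mulr0.
  by rewrite divfK // subr_eq0.
have c1 : {for t, continuous (fun x => complex.Re (g x))}.
  exact: (differentiable_continuous ((derivable1_diffP _ _).1 dg1)).
have c2 : {for t, continuous (fun x => complex.Im (g x))}.
  exact: (differentiable_continuous ((derivable1_diffP _ _).1 dg2)).
have Qa e : 0 < e -> \forall x \near t, cmod (Q (g x) - a) <= e.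
  move=> e0; have [d d0 H] := fQ e e0.
  have d20 : 0 < d / 2 by rewrite divr_gt0.
  have /cvgrPdist_lt/(_ _ d20) H1 := c1.
  have /cvgrPdist_lt/(_ _ d20) H2 := c2.
  near=> x; rewrite /Q; case: eqP => [_|/eqP gx]; first by rewrite subrr cmod0 ltW.
  apply: H => //; apply: (le_lt_trans (cmod_le_ReIm _)).
  rewrite [d]splitr !raddfB /= ltrD // distrC; near: x; [exact: H1|exact: H2].
have QRe : complex.Re (Q (g x)) @[x --> t] --> complex.Re a.
  apply/cvgrPdist_le => e /Qa; apply: filterS => x; apply: le_trans.
  by rewrite distrC -raddfB normRe_le_cmod.
have QIm : complex.Im (Q (g x)) @[x --> t] --> complex.Im a.
  apply/cvgrPdist_le => e /Qa; apply: filterS => x; apply: le_trans.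
  by rewrite distrC -raddfB normIm_le_cmod.
pose q1 h := complex.Re (Q (g (h + t))) * (h^-1 * (complex.Re (g (h + t)) - complex.Re (g t))).
pose q2 h := complex.Im (Q (g (h + t))) * (h^-1 * (complex.Im (g (h + t)) - complex.Im (g t))).
have quot : (fun h => h^-1 *: (((fun x => complex.Re (f (g x))) \o shift t) (h *: 1)
    - complex.Re (f (g t)))) = (fun h => q1 h - q2 h).
  apply/funext => h /=; rewrite -[_ *: 1]/(_ * 1) mulr1 /q1 /q2 -[_ *: _]/(_ * _).
  rewrite -raddfB QE; case: (Q _) => x y; case: (g _) => x1 y1; case: (g _) => x2 y2.
  by rewrite /=; ring.
have lim : h^-1 *: (((fun x => complex.Re (f (g x))) \o shift t) (h *: 1)
    - complex.Re (f (g t))) @[h --> 0^'] --> complex.Re (a * b).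
  rewrite quot (_ : complex.Re _ = complex.Re a * complex.Re b - complex.Im a * complex.Im b).
    have sh (F : R -> R) (l : R) : F x @[x --> t] --> l -> F (h + t) @[h --> 0^'] --> l.
      move=> Fl; apply: (@cvg_comp _ _ _ (fun h => h + t) F _ _ _ _ Fl).
      have : h + t @[h --> 0^'] --> 0 + t.
        by apply: cvgD; [move=> A; exact: nbhs_dnbhs|exact: cvg_cst].
      by rewrite add0r.
    have dq (G : R -> R) (l : R) : derivable G t 1 -> 'D_1 G t = l ->
        h^-1 * (G (h + t) - G t) @[h --> 0^'] --> l.
      move=> dG <-; suff -> : (fun h => h^-1 * (G (h + t) - G t)) =
        (fun h => h^-1 *: ((G \o shift t) (h *: 1) - G t)) by exact: dG.
      by apply/funext => h /=; rewrite -[_ *: 1]/(_ * 1) mulr1.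
    by apply: cvgB; apply: cvgM; [exact: (sh _ _ QRe)|exact: (dq _ _ dg1 dg1E)
      |exact: (sh _ _ QIm)|exact: (dq _ _ dg2 dg2E)].
  by case: a {fQ Q QE Qa QRe QIm q1 q2 quot} => ? ?; case: b {dg1E dg2E}.
apply: DeriveDef; first by apply: cvgP lim.
by apply/cvg_lim => //; exact: Rhausdorff.
Unshelve. all: by end_near.
Qed.

End ComplexDerivative.

(** * The fundamental theorem of calculus for bounded derivatives *)

Section RealIntegral.
Context {R : realType}.
Local Notation mu := (@lebesgue_measure R).
Implicit Types (f g dg : R -> R) (a b M : R).

Lemma is_derive_continuous g (x l : R) : is_derive x 1 g l -> {for x, continuous g}.
Proof. by case=> dg _; apply/differentiable_continuous/derivable1_diffP. Qed.

Lemma continuous_integrable a b f : continuous f ->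
  mu.-integrable `[a, b] (EFin \o f).
Proof.
move=> cf; apply: continuous_compact_integrable; first exact: segment_compact.
exact: continuous_subspaceT.
Qed.

Lemma is_derive_translate g (x t l : R) : is_derive (x + t) 1 g l ->
  is_derive x 1 (fun y => g (y + t)) l.
Proof.
move=> dg; rewrite -[l]mulr1; apply: (@is_derive1_comp _ g (fun y => y + t)).
by apply: is_derive_eq; rewrite addr0.
Qed.

(* [dg] need not be continuous: both sides are the derivative at [0] of
   [x |-> \int_a^b g (t + x) dt]. *)
Lemma ftc_bounded_derivative g dg M a b : a < b ->
  (forall t : R, is_derive t 1 g (dg t)) -> (forall t, `|dg t| <= M) ->
  \int[mu]_(t in `[a, b]) dg t = g b - g a.
Proof.
move=> ab gd gM.
have cg : continuous g by move=> x; apply: (is_derive_continuous (gd x)).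
pose f x t := g (t + x).
have fd (x t : R) : is_derive x 1 (f ^~ t) (dg (t + x)).
  rewrite /f (_ : (fun y => g (t + y)) = (fun y => g (y + t))).
    by apply: is_derive_translate; rewrite addrC; exact: gd.
  by apply/funext => y; rewrite addrC.
have cf x : continuous (f x).
  by move=> t; apply: (@is_derive_continuous _ _ (dg (t + x))); exact: is_derive_translate.
have I0 : (`]-1, 1[%classic : set R) 0 by rewrite /= in_itv /= ltrN10 ltr01.
have Mint : mu.-integrable `[a, b] (EFin \o cst M).
  by apply: continuous_integrable => x; exact: cst_continuous.
have M0 : 0 <= M by exact: le_trans (gM 0).
have bnd x t : (`]-1, 1[%classic : set R) x -> (`[a, b]%classic : set R) t ->
    `|partial1of2 f x t| <= cst M t.
  by move=> _ _; rewrite partial1of2E; have [_ ->] := fd x t; exact: gM.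
have K1 := @cvg_differentiation_under_integral R _ _ mu f `[a, b]%classic
  (measurable_itv _) 0 (-1) 1 I0 (fun x _ => continuous_integrable _ _ (cf x))
  (fun x t _ _ => @ex_derive _ _ _ _ _ _ _ (fd x t)) (cst M) (fun=> M0) Mint bnd.
(* The base point [a - 2] lies to the left of every [a + x] with [x > -1], so [G] is differentiable
   at all the points used. *)
pose G x := \int[mu]_(t in `[a - 2, x]) g t.
have Gd (x : R) : a - 2 < x -> is_derive x 1 G (g x).
  move=> ax; have [] := @continuous_FTC1_closed R g (a - 2) x (x + 1) _ _ ax (cg x).
  - by rewrite ltrDl.
  - exact: continuous_integrable.
  - by move=> d1 d2; apply: DeriveDef; [exact: d1|rewrite -derive1E; exact: d2].
pose K x := \int[mu]_(t in `[a, b]) f x t.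
have KG x : -1 < x -> K x = G (b + x) - G (a + x).
  move=> x1; rewrite /K /Rintegral (@continuous_FTC2 R (f x) (fun t => G (t + x)) a b ab) //.
  - exact/continuous_subspaceT.
  - have dG (t : R) : a <= t -> is_derive t 1 (fun t => G (t + x)) (g (t + x)).
      by move=> at_; apply: is_derive_translate; apply: Gd; lra.
    split.
    + by move=> t; rewrite in_itv /= => /andP[at_ _]; have [] := dG t (ltW at_).
    + by apply/cvg_at_right_filter/(is_derive_continuous (dG a (lexx a))).
    + by apply/cvg_at_left_filter/(is_derive_continuous (dG b (ltW ab))).
  - move=> t; rewrite in_itv /= => /andP[at_ _]; rewrite derive1E.
    suff: is_derive t 1 (fun t => G (t + x)) (g (t + x)) by case.
    by apply: is_derive_translate; apply: Gd; lra.
have K2 : is_derive (0:R) 1 (fun x => G (x + b) - G (x + a)) (g b - g a).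
  apply: is_deriveB; apply: is_derive_translate; rewrite add0r; apply: Gd; lra.
have {}K1 : h^-1 *: (K (h + 0) - K 0) @[h --> 0^'] --> \int[mu]_(t in `[a, b]) dg t.
  rewrite (_ : \int[mu]_(t in `[a, b]) dg t = \int[mu]_(t in `[a, b]) partial1of2 f 0 t) //.
  by apply: eq_Rintegral => t _; rewrite partial1of2E; have [_ ->] := fd 0 t; rewrite addr0.
have {K2} [dH HE] := K2.
set H := fun x => _ in dH HE.
have H1 : h^-1 *: (K (h + 0) - K 0) @[h --> 0^'] --> g b - g a.
  rewrite -HE; apply: cvg_trans (dH); apply: near_eq_cvg.
  rewrite near_withinE; near=> h => h0.
  have h1 : -1 < h by near: h; apply: lt_nbhsr; rewrite ltrN10.
  rewrite addr0 /= addr0 -[_ *: 1]/(_ * 1) mulr1 /H !(addrC _ b) !(addrC _ a).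
  by rewrite !KG ?ltrN10.
exact: (cvg_unique (@Rhausdorff R) K1 H1).
Unshelve. all: by end_near.
Qed.

End RealIntegral.

(** * Circles and the mean value property *)

Section BoundedHolo.
Context {R : realType}.
Local Notation C := R[i].
Implicit Types (S : set C) (f g : C -> C).

(** The bound on the derivative is the majorant for differentiating circle averages under the
    integral sign; the bound on [f] makes the class closed under products. *)
Definition bounded_holo S f := exists M : R, forall z, S z ->
  [/\ derivable f z (1 : C), cmod (f z) <= M & cmod ('D_(1 : C) f z) <= M].

Lemma bounded_holo_sub S S' f : S' `<=` S -> bounded_holo S f -> bounded_holo S' f.
Proof. by move=> SS [M H]; exists M => z /SS /H. Qed.

Lemma bounded_holo_cst S (c : C) : bounded_holo S (cst c).
Proof.
exists (cmod c) => z _; split => //.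
by rewrite derive_cst cmod0 cmod_ge0.
Qed.

Lemma bounded_holo_id S (M : R) : (forall z, S z -> cmod z <= M) -> bounded_holo S id.
Proof.
move=> SM; exists (Num.max M 1) => z Sz; split; first exact: derivable_id.
  by rewrite le_max SM.
by rewrite derive_id cmod1 le_max lexx orbT.
Qed.

Lemma bounded_holoD S f g : bounded_holo S f -> bounded_holo S g ->
  bounded_holo S (f + g).
Proof.
move=> [M Hf] [N Hg]; exists (M + N) => z Sz.
have [df f1 f2] := Hf z Sz; have [dg g1 g2] := Hg z Sz.
split; first exact: derivableD.
  by rewrite (le_trans (cmodD _ _)) // lerD.
by rewrite deriveD // (le_trans (cmodD _ _)) // lerD.
Qed.

Lemma bounded_holoN S f : bounded_holo S f -> bounded_holo S (- f).
Proof.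
move=> [M Hf]; exists M => z /Hf[df f1 f2].
by split; [exact: derivableN|rewrite cmodN|rewrite deriveN // cmodN].
Qed.

Lemma bounded_holoM S f g : bounded_holo S f -> bounded_holo S g ->
  bounded_holo S (f * g).
Proof.
move=> [M Hf] [N Hg]; exists (M * N + M * N) => z Sz.
have [df f1 f2] := Hf z Sz; have [dg g1 g2] := Hg z Sz.
have M0 : 0 <= M := le_trans (cmod_ge0 _) f1.
have N0 : 0 <= N := le_trans (cmod_ge0 _) g1.
have MN0 : 0 <= M * N by exact: mulr_ge0.
split.
- exact: derivableM df dg.
- apply: (@le_trans _ _ (M * N)); last by rewrite lerDl.
  rewrite (_ : (f * g) z = f z * g z) // cmodM.
  by rewrite ler_pM ?cmod_ge0.
- have -> : 'D_(1 : C) (f * g) z = f z * 'D_(1 : C) g z + g z * 'D_(1 : C) f z.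
    exact: (deriveM df dg).
  move: ('D_(1 : C) f z) ('D_(1 : C) g z) f2 g2 => a b f2 g2.
  apply: (le_trans (cmodD _ _)); rewrite !cmodM.
apply: lerD; first by rewrite ler_pM ?cmod_ge0.
  by rewrite [leRHS]mulrC ler_pM ?cmod_ge0.
Qed.

Lemma bounded_holoV S f (c : R) : 0 < c -> (forall z, S z -> c <= cmod (f z)) ->
  bounded_holo S f -> bounded_holo S (fun z => (f z)^-1).
Proof.
move=> c0 fc [M Hf]; exists (Num.max c^-1 (c^-2 * M)) => z Sz.
have [df f1 f2] := Hf z Sz.
have fz0 : 0 < cmod (f z) by rewrite (lt_le_trans c0) ?fc.
have fz : f z != 0 by rewrite -cmod_eq0 gt_eqF.
split.
- exact: (derivableV fz df).
- by rewrite cmodV le_max lef_pV2 ?posrE // fc.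
- have -> : 'D_(1 : C) (fun z => (f z)^-1) z = - (f z) ^- 2 * 'D_(1 : C) f z.
    exact: (deriveV fz df).
  move: ('D_(1 : C) f z) f2 => a f2.
  rewrite cmodM cmodN cmodV le_max; apply/orP; right.
rewrite expr2 cmodM ler_pM ?invr_ge0 ?mulr_ge0 ?cmod_ge0 //.
by rewrite lef_pV2 ?posrE ?mulr_gt0 ?exprn_gt0 // expr2 ler_pM ?(ltW c0) ?fc.
Qed.

Lemma bounded_holo_shift S f (c : C) : bounded_holo [set z + c | z in S] f ->
  bounded_holo S (fun z => f (z + c)).
Proof.
move=> [M H]; exists M => z Sz; have [|df f1 f2] := H (z + c); first by exists z.
have E : (fun h : C => h^-1 *: (((fun z => f (z + c)) \o shift z) (h *: (1 : C)) - f (z + c))) =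
    (fun h : C => h^-1 *: ((f \o shift (z + c)) (h *: (1 : C)) - f (z + c))).
  by apply/funext => h /=; rewrite addrA.
have -> : 'D_(1 : C) (fun z => f (z + c)) z = 'D_(1 : C) f (z + c).
  exact: (congr1 (fun F => lim (F @ (0 : C)^')) E).
split; [|exact: f1|exact: f2].
exact: (eq_ind_r (fun F => cvg (F @ (0 : C)^')) df E).
Qed.

End BoundedHolo.

Section MeanValue.
Context {R : realType}.
Local Notation C := R[i].
Local Notation mu := (@lebesgue_measure R).

Definition cis (t : R) : C := cos t +i* sin t.

Lemma cmod_cis t : cmod (cis t) = 1.
Proof. by rewrite /cmod normc_def /= cos2Dsin2 sqrtr1. Qed.

Lemma cmod_circle (r t : R) : 0 <= r -> cmod (r%:C * cis t) = r.
Proof. by move=> r0; rewrite cmodM cmod_real cmod_cis mulr1 ger0_norm. Qed.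

Lemma Re_realM (r : R) (z : C) : complex.Re (r%:C * z) = r * complex.Re z.
Proof. by case: z => a b /=; rewrite mul0r subr0. Qed.

Lemma Im_realM (r : R) (z : C) : complex.Im (r%:C * z) = r * complex.Im z.
Proof. by case: z => a b /=; rewrite mul0r addr0. Qed.

Lemma is_derive_Im_comp (f : C -> C) (g : R -> C) (t : R) (a b : C) :
  is_derive (g t) (1 : C) f a ->
  is_derive t 1 (fun x => complex.Re (g x)) (complex.Re b) ->
  is_derive t 1 (fun x => complex.Im (g x)) (complex.Im b) ->
  is_derive t 1 (fun x => complex.Im (f (g x))) (complex.Im (a * b)).
Proof.
move=> df d1 d2.
have E (z : C) : complex.Im z = complex.Re (- 'i * z) by case: z => x y; simpc.
rewrite (_ : (fun x => _) = fun x => complex.Re ((- 'i \*: f) (g x))); last first.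
  by apply/funext => x; rewrite E.
rewrite E mulrA; apply: is_derive_Re_comp => //.
Qed.

Lemma is_derive_ray (r t : R) :
  is_derive r 1 (fun x => complex.Re (x%:C * cis t)) (complex.Re (cis t)) /\
  is_derive r 1 (fun x => complex.Im (x%:C * cis t)) (complex.Im (cis t)).
Proof.
split.
  under eq_fun do rewrite Re_realM; apply: is_derive_eq.
  by rewrite scaler0 add0r -[_ *: _]/(_ * _) mulr1.
under eq_fun do rewrite Im_realM; apply: is_derive_eq.
by rewrite scaler0 add0r -[_ *: _]/(_ * _) mulr1.
Qed.

Lemma is_derive_radius (f : C -> C) (r t : R) (a : C) :
  is_derive (r%:C * cis t) (1 : C) f a ->
  is_derive r 1 (fun x => complex.Re (f (x%:C * cis t))) (complex.Re (a * cis t)).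
Proof.
move=> df; have [d1 d2] := is_derive_ray r t; exact: (is_derive_Re_comp df).
Qed.

Lemma is_derive_circle (r t : R) :
  is_derive t 1 (fun t => complex.Re (r%:C * cis t)) (complex.Re ('i * (r%:C * cis t))) /\
  is_derive t 1 (fun t => complex.Im (r%:C * cis t)) (complex.Im ('i * (r%:C * cis t))).
Proof.
split.
  under eq_fun do rewrite Re_realM; apply: is_derive_eq.
  by rewrite /= -[_ *: _]/(_ * _); ring.
under eq_fun do rewrite Im_realM; apply: is_derive_eq.
by rewrite /= -[_ *: _]/(_ * _); ring.
Qed.

Lemma Rintegral_circle_bound (f : R -> R) (e : R) : continuous f ->
  (forall t, `|f t| <= e) -> `|\int[mu]_(t in `[0, pi *+ 2]) f t| <= e * (pi *+ 2).
Proof.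
move=> cf fe; apply: (le_trans (le_normr_Rintegral _ _)) => //.
  exact: continuous_integrable.
apply: (@le_trans _ _ (\int[mu]_(t in `[0, pi *+ 2]) e)).
  apply: le_Rintegral => //.
    by apply: continuous_integrable => x; apply: cvg_norm; exact: cf.
  by apply: continuous_integrable => x; exact: cvg_cst.
rewrite Rintegral_cst //= lebesgue_measure_itv /= lte_fin.
by rewrite pmulrn_lgt0 // pi_gt0 /= subr0.
Qed.

End MeanValue.

Section MeanValueTheorem.
Context {R : realType}.
Local Notation C := R[i].
Local Notation mu := (@lebesgue_measure R).
Implicit Types (f : C -> C).

Lemma circle_continuous f (r : R) :
  (forall t : R, derivable f (r%:C * cis t) (1 : C)) ->
  continuous (fun t => complex.Re (f (r%:C * cis t))).
Proof.
move=> df t; have [d1 d2] := is_derive_circle r t.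
have fd : is_derive (r%:C * cis t) (1 : C) f ('D_(1 : C) f (r%:C * cis t)).
  exact: DeriveDef.
exact: (is_derive_continuous (is_derive_Re_comp fd d1 d2)).
Qed.

(* [f] may be singular at [0].  The radial derivative of the circle average of
   [Re f] is the average of the angular derivative of [Im f / r], which is [0]. *)
Lemma mean_value f (L : C) (rho r : R) : 0 < r < rho ->
  (forall a, 0 < a -> bounded_holo [set z | a < cmod z < rho] f) ->
  (forall e : R, 0 < e -> exists2 d : R, 0 < d & forall z,
     0 < cmod z < d -> cmod (f z - L) <= e) ->
  \int[mu]_(t in `[0, pi *+ 2]) complex.Re (f (r%:C * cis t)) =
  complex.Re L * (pi *+ 2).
Proof.
move=> /andP[r0 rrho] Hf fL.
have pi2 : 0 < pi *+ 2 :> R by rewrite pmulrn_lgt0 // pi_gt0.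
pose J (x : R) := \int[mu]_(t in `[0, pi *+ 2]) complex.Re (f (x%:C * cis t)).
have [D DE] : exists D : C -> C, forall z, 'D_(1 : C) f z = D z by exists (fun z => 'D_(1 : C) f z).
have df z : 0 < cmod z < rho -> is_derive z (1 : C) f (D z).
  move=> /andP[z0 zr]; have [|M /(_ z) []] := Hf (cmod z / 2).
  - by rewrite divr_gt0.
  - by apply/andP; split => //; rewrite ltr_pdivrMr // mulr2n mulrDr mulr1 ltrDl.
  - by move=> d _ _; apply: DeriveDef.
have dfc (x t : R) : 0 < x < rho ->
    is_derive (x%:C * cis t) (1 : C) f (D (x%:C * cis t)).
  by move=> /andP[x0 xr]; apply: df; rewrite cmod_circle ?x0 // ltW.
have cf x : 0 < x < rho -> continuous (fun t => complex.Re (f (x%:C * cis t))).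
  by move=> xr; apply: circle_continuous => t; have [] := dfc _ t xr.
have dJ x : 0 < x < rho -> is_derive x 1 J 0.
  move=> /andP[x0 xr].
  (* The annulus stays away from the possible singularity at [0] and contains all circles of radius
     close to [x]. *)
  have [M HM] := Hf (x / 2) (divr_gt0 x0 (ltr0n _ 2)).
  pose F x t := complex.Re (f (x%:C * cis t)).
  have Ix : (`]x / 2, rho[%classic : set R) x.
    by rewrite /= in_itv /= xr andbT ltr_pdivrMr // mulr2n mulrDr mulr1 ltrDl.
  have Ipos y : (`]x / 2, rho[%classic : set R) y -> 0 < y < rho.
    by rewrite /= in_itv /= => /andP[y1 ->]; rewrite andbT (lt_trans _ y1) // divr_gt0.
  have dF y t : (`]x / 2, rho[%classic : set R) y ->
      is_derive y 1 (F ^~ t) (complex.Re (D (y%:C * cis t) * cis t)).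
    by move=> /Ipos yr; apply: is_derive_radius; exact: dfc.
  have bound y t : (`]x / 2, rho[%classic : set R) y ->
      cmod (D (y%:C * cis t)) <= M.
    move=> Iy; have /andP[y0 yr] := Ipos y Iy.
    have [|_ _] := HM (y%:C * cis t); last by rewrite DE.
    by rewrite /= cmod_circle ?(ltW y0) //; move: Iy; rewrite /= in_itv.
  have M0 : 0 <= M by exact: le_trans (cmod_ge0 _) (bound x 0 Ix).
  have Mint : mu.-integrable `[0, pi *+ 2] (EFin \o cst M).
    by apply: continuous_integrable => y; exact: cst_continuous.
  have bnd y t : (`]x / 2, rho[%classic : set R) y ->
      (`[0, pi *+ 2]%classic : set R) t -> `|partial1of2 F y t| <= cst M t.
    move=> Iy _; rewrite partial1of2E; have [_ ->] := dF y t Iy.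
    apply: (le_trans (normRe_le_cmod _)).
    have := bound y t Iy; move: (D _) => a.
    by rewrite cmodM cmod_cis mulr1.
  have Fint y : (`]x / 2, rho[%classic : set R) y ->
      mu.-integrable `[0, pi *+ 2] (EFin \o F y).
    by move=> /Ipos yr; apply: continuous_integrable; exact: cf.
  have dF1 y t : (`]x / 2, rho[%classic : set R) y ->
    (`[0, pi *+ 2]%classic : set R) t -> derivable (F ^~ t) y 1.
    by move=> Iy _; have [] := dF y t Iy.
  have D1 := @derivable_under_integral R _ _ mu F `[0, pi *+ 2]%classic
    (measurable_itv _) x (x / 2) rho Ix Fint dF1 (cst M) (fun=> M0) Mint bnd.
  have D2 := @differentiation_under_integral R _ _ mu F `[0, pi *+ 2]%classic
    (measurable_itv _) x (x / 2) rho Ix Fint dF1 (cst M) (fun=> M0) Mint bnd.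
  apply: DeriveDef; first exact: D1.
  rewrite -derive1E; apply: (etrans D2).
  transitivity (\int[mu]_(t in `[0, pi *+ 2])
      complex.Re (D (x%:C * cis t) * cis t)).
    by apply: eq_Rintegral => t _; rewrite partial1of2E; have [_ ->] := dF x t Ix.
  pose g t := x^-1 * complex.Im (f (x%:C * cis t)).
  transitivity (g (pi *+ 2) - g 0); last first.
    by rewrite /g /cis cos2pi sin2pi cos0 sin0 subrr.
  apply: (@ftc_bounded_derivative _ g (fun t =>
    complex.Re (D (x%:C * cis t) * cis t)) M _ _ pi2).
  - move=> t; have [d1 d2] := is_derive_circle x t.
    have dI := is_derive_Im_comp (dfc x t (Ipos _ Ix)) d1 d2.
    apply: (is_derive_eq (is_deriveZ x^-1 dI)).
    move: (cis t) (D _) => [b1 b2] [a1 a2]; rewrite -[_ *: _]/(_ * _) /=.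
    by field; rewrite gt_eqF.
  - move=> t; apply: (le_trans (normRe_le_cmod _)).
    have := bound x t Ix; move: (D _) => a.
    by rewrite cmodM cmod_cis mulr1.
have Jcst x y : 0 < x -> x < y -> y < rho -> J x = J y.
  move=> x0 xy yr; have [||c _ /eqP] := @MVT _ J (fun=> 0) x y xy.
  - move=> z; rewrite in_itv /= => /andP[xz zy]; apply: dJ.
    by rewrite (lt_trans x0) // (lt_trans zy).
  - apply: derivable_within_continuous => z; rewrite in_itv /= => /andP[xz zy].
    have zr : 0 < z < rho by rewrite (lt_le_trans x0) // (le_lt_trans zy).
    by have [] := dJ z zr.
  - by rewrite mul0r subr_eq0 => /eqP ->.
(* The average does not depend on the radius, so it may be computed on a circle so small that [f] is
   within [e / (2 pi)] of [L]. *)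
rewrite -/(J r); apply/eqP; rewrite -subr_eq0 -normr_le0; apply/ler_addgt0Pl => e e0.
rewrite addr0.
have e1 : 0 < e / (pi *+ 2) by rewrite divr_gt0.
have [d d0 Hd] := fL _ e1.
have [x /andP[x0 xr] xd] : exists2 x, 0 < x < r & x < d.
  exists (Num.min r d / 2); last first.
    by rewrite ltr_pdivrMr // (@le_lt_trans _ _ d) ?ge_min ?lexx ?orbT // mulr2n mulrDr mulr1 ltrDl.
  rewrite divr_gt0 ?lt_min ?r0 //= ltr_pdivrMr // (@le_lt_trans _ _ r) ?ge_min ?lexx //.
  by rewrite mulr2n mulrDr mulr1 ltrDl.
have xrho : 0 < x < rho by rewrite x0 (lt_trans xr).
rewrite -(Jcst x r) // /J.
have -> : complex.Re L * (pi *+ 2) = \int[mu]_(t in `[0, pi *+ 2]) (complex.Re L).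
  by rewrite Rintegral_cst //= lebesgue_measure_itv /= lte_fin pi2 /= subr0.
rewrite -RintegralB //; first last.
- by apply: continuous_integrable => t; exact: cvg_cst.
- by apply: continuous_integrable; exact: cf.
rewrite -[leRHS](@divfK _ (pi *+ 2)) ?gt_eqF //.
apply: Rintegral_circle_bound.
  by move=> t; apply: cvgB; [exact: cf|exact: cvg_cst].
move=> t; rewrite -raddfB (le_trans (normRe_le_cmod _)) // Hd //.
by rewrite cmod_circle ?x0 // ltW.
Qed.

End MeanValueTheorem.

(** * Cauchy and Taylor estimates on complex lines *)

Section Slices.
Context {R : realType}.
Local Notation C := R[i].
Local Notation mu := (@lebesgue_measure R).

Lemma is_derive_slice (V : normedModType C) (f : V -> C) (w v : V) (z : C) :
  derivable f (w + z *: v) v ->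
  is_derive z (1 : C) (fun z => f (w + z *: v)) ('D_v f (w + z *: v)).
Proof.
move=> df; pose F z := f (w + z *: v).
have E : (fun h : C => h^-1 *: ((F \o shift z) (h *: (1 : C)) - F z)) =
    (fun h : C => h^-1 *: ((f \o shift (w + z *: v)) (h *: v) - f (w + z *: v))).
  apply/funext => h; congr (_ *: (f _ - _)).
  by rewrite /= -[h *: 1]/(h * 1) mulr1 scalerDl addrCA.
apply: DeriveDef.
  exact: (eq_ind_r (fun F => cvg (F @ (0 : C)^')) df E).
exact: (congr1 (fun F => lim (F @ (0 : C)^')) E).
Qed.

(** The mean value theorem fails for complex values; it is applied to a real part, after a rotation
    that makes [F 1 - F 0 - a] real and nonnegative. With [a = 0] this is a Lipschitz bound, with
    [a] a derivative it is a Taylor bound. *)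
Lemma mean_value_ineq (F D : C -> C) (a : C) (K : R) :
  (forall t : R, 0 <= t <= 1 ->
     is_derive (t%:C) (1 : C) F (D t%:C) /\ cmod (D t%:C - a) <= K) ->
  cmod (F 1 - F 0 - a) <= K.
Proof.
move=> H; have [c c1 ->] := cmod_Re_rot (F 1 - F 0 - a).
pose g (t : R) := complex.Re (c * F t%:C) - t * complex.Re (c * a).
have dg (t : R) : 0 <= t <= 1 -> is_derive t 1 g (complex.Re (c * D t%:C) - complex.Re (c * a)).
  move=> /H[dF _]; apply: is_deriveB.
    rewrite -[c * D _]mulr1.
    apply: (@is_derive_Re_comp _ (c \*: F) (fun t => t%:C) t (c * D t%:C) 1).
    exact: (is_derive_cst (0 : R)).
  rewrite (_ : *%R^~ _ = complex.Re (c * a) \*: id).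
    have X := is_deriveZ (complex.Re (c * a)) (is_derive_id t (1 : R)).
    by apply: (is_derive_eq X); exact: mulr1.
  by apply/funext => x; rewrite mulrC.
have [||t t01] := @MVT _ g (fun t => complex.Re (c * D t%:C) - complex.Re (c * a)) 0 1 ltr01.
- by move=> t; rewrite in_itv /= => /andP[t0 t1]; apply: dg; rewrite !ltW.
- by apply: derivable_within_continuous => t; rewrite in_itv /= => /dg[].
rewrite subr0 mulr1 /g mul1r mul0r subr0 addrAC -!raddfB -!mulrBr => ->.
apply: (le_trans (Re_le_cmod _)); rewrite cmodM c1 mul1r.
by have [|_] := H t; first by move: t01; rewrite in_itv /= => /andP[? ?]; rewrite !ltW.
Qed.

(** Cauchy's formula for the derivative at the centre: the difference quotient has a removable
    singularity at [0] with value [a], which is why [mean_value] allows [f] to be singular there. *)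
Lemma derive_circle_mean (F : C -> C) (a : C) (rho r : R) : 0 < r < rho ->
  bounded_holo [set z | cmod z < rho] F -> is_derive (0 : C) (1 : C) F a ->
  \int[mu]_(t in `[0, pi *+ 2]) complex.Re ((F (r%:C * cis t) - F 0) / (r%:C * cis t)) =
  complex.Re a * (pi *+ 2).
Proof.
move=> rr HF dF.
apply: (@mean_value _ (fun z => (F z - F 0) / z) a _ _ rr).
  move=> b b0.
  apply: (@bounded_holoM _ _ (F - cst (F 0)) (fun z => z^-1)).
    apply: bounded_holoD; last by apply: bounded_holoN; exact: bounded_holo_cst.
    by apply: bounded_holo_sub HF => z /andP[].
  apply: (bounded_holoV b0).
    by move=> z /andP[/ltW].
  by apply: (@bounded_holo_id _ _ rho) => z /andP[_ /ltW].
move=> e e0; have [d d0 H] := is_derive_quotient dF e0.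
exists d => // z /andP[z0 zd]; have := H z; rewrite subr0; apply => //.
by rewrite -cmod_eq0 gt_eqF.
Qed.

Lemma cderivable_inv (z : C) : z != 0 -> derivable (fun z : C => z^-1) z (1 : C).
Proof.
move=> z0; have dz : derivable (id : C -> C) z (1 : C) by exact: derivable_id.
have zn : id z != 0 by [].
exact: (derivableV zn dz).
Qed.

Section Ball.
Context {V : normedModType C} (f : V -> C) (z0 : V) (rho B K : R).
Hypothesis rho0 : 0 < rho.
Hypothesis fb : forall w, rnorm (w - z0) < rho *+ 2 ->
  [/\ forall v, derivable f w v, cmod (f w) <= B & forall v, cmod ('D_v f w) <= K * rnorm v].

Lemma ball_segment (w v : V) (r t : R) : 0 <= t <= 1 -> rnorm (w - z0) < r ->
  rnorm (w + v - z0) < r -> rnorm (w + t%:C *: v - z0) < r.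
Proof.
move=> /andP[t0 t1] wr vr.
have -> : w + t%:C *: v - z0 = (1 - t)%:C *: (w - z0) + t%:C *: (w + v - z0).
  rewrite [w + v - z0]addrAC [w + _ - z0]addrAC [t%:C *: (_ + v)]scalerDr addrA -scalerDl -rmorphD /=.
  by rewrite subrK scale1r.
apply: (le_lt_trans (rnormD _ _)); rewrite !rnormZ !cmod_real !ger0_norm ?subr_ge0 //.
have [->|tn0] := eqVneq t 0; first by rewrite mul0r addr0 subr0 mul1r.
have tp : 0 < t by rewrite lt_def tn0.
rewrite (_ : r = (1 - t) * r + t * r); last by ring.
by rewrite ler_ltD // ?ltr_pM2l // ler_wpM2l ?subr_ge0 // ltW.
Qed.

Lemma ball_lipschitz w w' : rnorm (w - z0) < rho *+ 2 -> rnorm (w' - z0) < rho *+ 2 ->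
  cmod (f w' - f w) <= K * rnorm (w' - w).
Proof.
move=> hw hw'; set v := w' - w.
have := @mean_value_ineq (fun z => f (w + z *: v)) (fun z => 'D_v f (w + z *: v)) 0 (K * rnorm v).
rewrite scale1r scale0r addr0 subr0 /v [w + _]addrC subrK; apply => t t01.
have [|dv _ Dv] := fb (w := w + t%:C *: v).
  by apply: ball_segment => //; rewrite /v [w + _]addrC subrK.
by split; [apply: is_derive_slice; exact: dv|rewrite subr0; exact: Dv].
Qed.

(** Both derivatives are circle averages of difference quotients in the direction [v]. The
    difference of the numerators is at most [2 K |w - w'|] by [ball_lipschitz], and division by the
    radius [rho / (2 |v|)] gives the constant. This replaces a bound on second derivatives. *)
Lemma ball_derive_lipschitz w w' v : rnorm (w - z0) < rho -> rnorm (w' - z0) < rho ->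
  cmod ('D_v f w - 'D_v f w') <= 4 * K / rho * rnorm (w - w') * rnorm v.
Proof.
move=> hw hw'.
have [->|v0] := eqVneq v 0; first by rewrite !derive0 subrr cmod0 rnorm0 mulr0.
have nv0 : 0 < rnorm v by rewrite rnorm_gt0.
(* For [|z| < rho1] the point [u + z v] is within [rho] of [u], hence in the doubled ball; [r] is
   half of [rho1]. *)
pose r := rho / (2 * rnorm v); pose rho1 := rho / rnorm v.
have r0 : 0 < r by rewrite divr_gt0 // mulr_gt0.
have rr : 0 < r < rho1.
  by rewrite r0 /r /rho1 ltr_pM2l // ltf_pV2 ?posrE ?mulr_gt0 // mulr_natl mulr2n ltrDl.
have inball u z : rnorm (u - z0) < rho -> cmod z < rho1 -> rnorm (u + z *: v - z0) < rho *+ 2.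
  move=> hu hz; rewrite addrAC (le_lt_trans (rnormD _ _)) // mulr2n ltrD // rnormZ.
  by rewrite -ltr_pdivlMr.
have [c c1 ->] := cmod_Re_rot ('D_v f w - 'D_v f w').
pose F u (z : C) := c * f (u + z *: v).
have dF u z : rnorm (u - z0) < rho -> cmod z < rho1 ->
    is_derive z (1 : C) (F u) (c * 'D_v f (u + z *: v)).
  move=> hu hz; have [dv _ _] := fb (inball u z hu hz).
  by have := is_deriveZ c (is_derive_slice (dv v)).
have bF u : rnorm (u - z0) < rho -> bounded_holo [set z | cmod z < rho1] (F u).
  move=> hu; exists (Num.max B (K * rnorm v)) => z hz; have [d dE] := dF u z hu hz.
  have [_ fB Df] := fb (inball u z hu hz).
  split => //; first by rewrite /F cmodM c1 mul1r le_max fB.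
  rewrite dE; move: (Df v); move: ('D_v f _) => a aK.
  by rewrite cmodM c1 mul1r le_max aK orbT.
have mF u : rnorm (u - z0) < rho ->
  \int[mu]_(t in `[0, pi *+ 2]) complex.Re ((F u (r%:C * cis t) - F u 0) / (r%:C * cis t)) =
  complex.Re (c * 'D_v f u) * (pi *+ 2).
  move=> hu; suff X : is_derive (0 : C) (1 : C) (F u) (c * 'D_v f u).
    exact: (@derive_circle_mean (F u) (c * 'D_v f u) rho1 r rr (bF u hu) X).
  have [|d dE] := dF u 0 hu.
    by rewrite cmod0; case/andP: rr => /lt_trans; apply.
  have E : u + 0 *: v = u by rewrite scale0r addr0.
  exact: (DeriveDef d (etrans dE (congr1 (fun x => c * 'D_v f x) E))).
have cF u : rnorm (u - z0) < rho ->
    continuous (fun t => complex.Re ((F u (r%:C * cis t) - F u 0) / (r%:C * cis t))).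
  move=> hu; apply: (@circle_continuous _ (fun z => (F u z - F u 0) / z)) => t.
  have zr : cmod (r%:C * cis t) < rho1 by rewrite cmod_circle ?ltW //; case/andP: rr.
  have [d _] := dF u _ hu zr.
  apply: (@derivableM _ _ (F u - cst (F u 0)) (fun z => z^-1)).
    exact: (derivableB d (derivable_cst _ _ _)).
  by apply: cderivable_inv; rewrite -cmod_eq0 cmod_circle ?ltW // gt_eqF.
have pi2 : 0 < pi *+ 2 :> R by rewrite pmulrn_lgt0 // pi_gt0.
have E1 := mF w hw; have E2 := mF w' hw'; have c1' := cF w hw; have c2' := cF w' hw'.
move: ('D_v f w) ('D_v f w') E1 E2 => a b E1 E2.
rewrite -(ler_pM2r pi2) mulrBr raddfB mulrBl -E1 -E2 -RintegralB //; first last.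
- exact: continuous_integrable.
- exact: continuous_integrable.
apply: (le_trans (ler_norm _)); apply: Rintegral_circle_bound.
  by move=> t; apply: cvgB; [exact: c1'|exact: c2'].
move=> t; rewrite -raddfB -mulrBl (le_trans (normRe_le_cmod _)) //.
set z := r%:C * cis t; have zr : cmod z = r by rewrite cmod_circle // ltW.
have -> : F w z - F w 0 - (F w' z - F w' 0) =
    c * ((f (w + z *: v) - f (w' + z *: v)) - (f w - f w')).
  by rewrite /F !scale0r !addr0; ring.
rewrite 2!cmodM c1 mul1r cmodV zr ler_pdivrMr //.
have K1 : cmod (f (w + z *: v) - f (w' + z *: v)) <= K * rnorm (w - w').
  have -> : w - w' = (w + z *: v) - (w' + z *: v) by rewrite opprD addrACA subrr addr0.
  by apply: ball_lipschitz; apply: inball => //; rewrite zr; case/andP: rr.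
have K2 : cmod (f w - f w') <= K * rnorm (w - w').
  by apply: ball_lipschitz; apply: (@lt_trans _ _ rho) => //; rewrite mulr2n ltrDl.
apply: (le_trans (cmodD _ _)); rewrite cmodN (le_trans (lerD K1 K2)) //.
rewrite le_eqVlt; apply/orP; left; apply/eqP; rewrite /r; field.
by rewrite !gt_eqF.
Qed.

(** Along the segment from [w] to [w + v] the derivative in the direction [v] stays within
    [4 K / rho * |v|^2] of its value at [w], so [mean_value_ineq] applies with that value as [a]. *)
Lemma ball_taylor w v : rnorm (w - z0) < rho -> rnorm (w + v - z0) < rho -> 0 <= K ->
  cmod (f (w + v) - f w - 'D_v f w) <= 4 * K / rho * rnorm v ^+ 2.
Proof.
move=> hw hv K0.
have := @mean_value_ineq (fun z => f (w + z *: v)) (fun z => 'D_v f (w + z *: v))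
  ('D_v f w) (4 * K / rho * rnorm v ^+ 2).
rewrite scale1r scale0r addr0; apply => t t01.
have hb := ball_segment t01 hw hv.
split.
  have [|dv _ _] := fb (w := w + t%:C *: v); first by rewrite (lt_trans hb) // mulr2n ltrDl.
  by apply: is_derive_slice; exact: dv.
apply: (le_trans (ball_derive_lipschitz _ hb hw)).
rewrite addrAC subrr add0r rnormZ cmod_real expr2 [leRHS]mulrA ler_wpM2r ?rnorm_ge0 //.
case/andP: t01 => t0 t1; rewrite ger0_norm // ler_wpM2l ?ler_piMl ?rnorm_ge0 //.
by rewrite divr_ge0 ?mulr_ge0 // ltW.
Qed.

End Ball.
End Slices.

(** * Harnack's inequality *)

Section Harnack.
Context {R : realType}.
Local Notation C := R[i].
Local Notation mu := (@lebesgue_measure R).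

(* At [z = 0] both sides are the junk value [ln 0 = 0]. *)
Lemma ln_cmod (z : C) :
  ln (cmod z) = 2^-1 * ln (complex.Re z ^+ 2 + complex.Im z ^+ 2).
Proof.
have [->|z0] := eqVneq z 0.
  by rewrite cmod0 /= expr0n addr0 ln0 // mulr0.
have p : 0 < cmod z by rewrite lt_def cmod_eq0 z0 cmod_ge0.
by rewrite -cmod_sqr lnXn // -[ln _ *+ 2]mulr_natl mulrA mulVf ?mul1r ?pnatr_eq0.
Qed.

(** The real part of the logarithmic derivative, obtained from the real formula [ln_cmod] rather
    than from a branch of the complex logarithm. *)
Lemma is_derive_ln_cmod (h : R -> C) (t : R) (b : C) : h t != 0 ->
  is_derive t 1 (fun x => complex.Re (h x)) (complex.Re b) ->
  is_derive t 1 (fun x => complex.Im (h x)) (complex.Im b) ->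
  is_derive t 1 (fun x => ln (cmod (h x))) (complex.Re (b / h t)).
Proof.
move=> h0 d1 d2.
rewrite (_ : (fun x => _) = (2^-1 \*: (@ln R \o
    ((fun x => complex.Re (h x)) * (fun x => complex.Re (h x)) +
     (fun x => complex.Im (h x)) * (fun x => complex.Im (h x)))))); last first.
  by apply/funext => x; rewrite ln_cmod !expr2.
have p : 0 < complex.Re (h t) ^+ 2 + complex.Im (h t) ^+ 2.
  by rewrite -cmod_sqr exprn_gt0 // lt_def cmod_eq0 h0 cmod_ge0.
have dl := is_derive1_ln p; rewrite !expr2 in dl.
have dG := is_deriveD (is_deriveM d1 d1) (is_deriveM d2 d2).
have X := is_deriveZ 2^-1 (@is_derive1_comp _ (@ln R) _ t _ _ dl dG).
apply: (is_derive_eq X); rewrite -!expr2 -![_ *: _]/(_ * _).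
move: p; case: (h t) => x y; case: b {d1 d2 dG X} => u v /= p.
by field; rewrite gt_eqF.
Qed.

Lemma mean_value_disc (F : C -> C) (rho r : R) : 0 < r < rho ->
  bounded_holo [set z | cmod z < rho] F ->
  \int[mu]_(t in `[0, pi *+ 2]) complex.Re (F (r%:C * cis t)) =
  complex.Re (F 0) * (pi *+ 2).
Proof.
move=> /andP[r0 rr] HF; apply: (@mean_value _ F (F 0) rho r); first by rewrite r0.
  by move=> a a0; apply: bounded_holo_sub HF => z /andP[].
move=> e e0.
have cF : {for (0 : C), continuous F}.
  have [M /(_ 0) []] := HF; first by rewrite /= cmod0 (lt_trans r0).
  by move=> dF _ _; apply/differentiable_continuous/derivable1_diffP.
have /cvgrPdist_le/(_ e%:C) := cF; rewrite ltcR => /(_ e0)/nbhs_rnormP[d d0 H].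
exists d => // z /andP[_ zd]; have := H z; rewrite subr0 => /(_ zd).
by move=> Fz; rewrite cmodB -lecR -norm_cmod; exact: Fz.
Qed.

Lemma Rintegral_cos : \int[mu]_(t in `[0, pi *+ 2]) cos t = 0.
Proof.
have pi2 : 0 < pi *+ 2 :> R by rewrite pmulrn_lgt0 // pi_gt0.
rewrite (@ftc_bounded_derivative _ sin cos 1 _ _ pi2).
- by rewrite sin2pi sin0 subrr.
- by move=> t; rewrite ler_norml cos_geN1 cos_le1.
Qed.

Lemma is_derive_line (f : C -> C) (z t e a : C) : is_derive (z + t * e) (1 : C) f a ->
  is_derive t (1 : C) (fun t => f (z + t * e)) (a * e).
Proof.
move=> [d dE].
have df : differentiable f (z + t *: e) := (derivable1_diffP _ _).1 d.
have De : 'D_e f (z + t *: e) = a * e.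
  have -> : 'D_e f (z + t *: e) = 'd f (z + t *: e) (e *: (1 : C)).
    by rewrite (deriveE _ df) -[e *: 1]/(e * 1) mulr1.
  rewrite linearZ mulrC -dE; congr (_ * _).
  by rewrite (deriveE _ df).
have [d1 d1E] := is_derive_slice (diff_derivable (v := e) df).
apply: DeriveDef; first exact: d1.
exact: (etrans d1E De).
Qed.

Lemma ReB (z w : C) : complex.Re (z - w) = complex.Re z - complex.Re w.
Proof. exact: raddfB. Qed.

Lemma ImB (z w : C) : complex.Im (z - w) = complex.Im z - complex.Im w.
Proof. exact: raddfB. Qed.

Lemma near_circle (r t d : R) : 0 < d ->
  \forall x \near t, cmod (r%:C * cis x - r%:C * cis t) < d.
Proof.
move=> d0; have [d1 d2] := is_derive_circle r t.
have {}d1 := is_derive_continuous d1; have {}d2 := is_derive_continuous d2.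
have d20 : 0 < d / 2 by rewrite divr_gt0.
have /cvgrPdist_lt/(_ _ d20) H1 := d1.
have /cvgrPdist_lt/(_ _ d20) H2 := d2.
near=> x; rewrite cmodB; apply: (le_lt_trans (cmod_le_ReIm _)).
by rewrite [d]splitr ReB ImB; apply: ltrD; near: x; [exact: H1|exact: H2].
Unshelve. all: by end_near.
Qed.

Lemma continuous_Re_circle (H : C -> C) (r : R) :
  (forall t, {for r%:C * cis t, continuous H}) ->
  continuous (fun t : R => complex.Re (H (r%:C * cis t))).
Proof.
move=> cH t; apply/cvgrPdist_lt => e e0.
have /cvgrPdist_lt/(_ e%:C) := cH t; rewrite ltcR => /(_ e0)/nbhs_rnormP[d d0 Hd].
apply: filterS (near_circle r t d0) => x /Hd.
by rewrite norm_cmod ltcR; apply: le_lt_trans; rewrite -ReB normRe_le_cmod.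
Qed.

Section Gradient.
Context (f D : C -> C) (rho B K L : R).
Hypothesis fd : forall z, cmod z < rho -> is_derive z (1 : C) f (D z).
Hypothesis f1 : forall z, cmod z < rho -> 1 <= cmod (f z).
Hypothesis fB : forall z, cmod z < rho -> cmod (f z) <= B.
Hypothesis DK : forall z, cmod z < rho -> cmod (D z) <= K.
Hypothesis DL : forall z w, cmod z < rho -> cmod w < rho ->
  cmod (D z - D w) <= L * cmod (z - w).

Let f_neq0 z : cmod z < rho -> f z != 0.
Proof. by move=> /f1; apply: contraTneq => ->; rewrite cmod0 -ltNge. Qed.

Let fholo : bounded_holo [set z | cmod z < rho] f.
Proof.
exists (Num.max B K) => z /= zr; have [d dE] := fd zr.
split; [exact: d|by rewrite le_max fB|].
by rewrite dE; rewrite le_max DK ?orbT.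
Qed.


(** The difference quotients approach [D] at a rate that does not depend on [z]; this allows the
    passage to the limit under the circle average. *)
Lemma difference_quotient_dist (z e : C) : e != 0 -> cmod z + cmod e < rho ->
  cmod ((f (z + e) - f z) / e - D z) <= L * cmod e.
Proof.
move=> e0 zr.
have e_gt0 : 0 < cmod e by rewrite lt_def cmod_eq0 e0 cmod_ge0.
have inb (t : R) : 0 <= t <= 1 -> cmod (z + t%:C * e) < rho.
  move=> /andP[t0 t1]; apply: le_lt_trans zr; apply: (le_trans (cmodD _ _)).
  by rewrite lerD2l cmodM cmod_real ger0_norm // ler_piMl ?cmod_ge0.
have z0 : cmod z < rho by apply: le_lt_trans zr; rewrite lerDl cmod_ge0.
have := @mean_value_ineq _ (fun t => f (z + t * e)) (fun t => D (z + t * e) * e) (D z * e)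
  (L * cmod e * cmod e).
rewrite mul1r mul0r addr0 => H.
have -> : (f (z + e) - f z) / e - D z = (f (z + e) - f z - D z * e) / e.
  by rewrite [RHS]mulrBl mulfK.
rewrite cmodM cmodV ler_pdivrMr //; apply: H => t t01; split.
  have [d dE] := fd (inb t t01).
  have dv : is_derive (z + t%:C * e) (1 : C) f (D (z + t%:C * e)) by exact: DeriveDef d dE.
  exact: is_derive_line.
rewrite -mulrBl cmodM ler_wpM2r ?cmod_ge0 // (le_trans (DL (inb t t01) z0)) //.
rewrite addrAC subrr add0r; case/andP: t01 => t0 t1.
rewrite cmodM cmod_real ger0_norm //.
have L0 : 0 <= L * cmod e.
  have ze : cmod (z + e) < rho by apply: le_lt_trans zr; exact: cmodD.
  have := DL ze z0; rewrite addrAC subrr add0r; apply: le_trans; exact: cmod_ge0.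
by rewrite mulrCA ler_piMl.
Qed.

Let D_continuous (z : C) : cmod z < rho -> {for z, continuous D}.
Proof.
move=> zr.
have nF : Filter (nbhs (z : C)) by exact: nbhs_filter.
apply/(@cvgrPdist_le _ _ _ (nbhs z) nF D (D z)) => e; rewrite ltcE => /andP[/eqP /= e1 e2].
pose e' := complex.Re e.
have r0 : 0 < rho - cmod z by rewrite subr_gt0.
have L0 : 0 < `|L| + 1 by rewrite ltr_wpDl.
apply/nbhs_rnormP; exists (Num.min (rho - cmod z) (e' / (`|L| + 1))).
  by rewrite lt_min r0 divr_gt0.
move=> w; rewrite lt_min => /andP[w1 w2].
have wr : cmod w < rho.
  rewrite -(subrK z w); apply: (le_lt_trans (cmodD _ _)).
  by rewrite -ltrBrDr.
rewrite norm_cmod lecE /= e1 eqxx /= (le_trans (DL zr wr)) //.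
apply: (@le_trans _ _ ((`|L| + 1) * cmod (z - w))).
  by rewrite ler_wpM2r ?cmod_ge0 // (le_trans (ler_norm _)) // lerDl.
by rewrite cmodB mulrC -ler_pdivlMr // ltW.
Qed.

(* On the circle of radius [x] this is [(1 + cos t) e^(it)]; the nonnegative
   factor [1 + cos t] makes the average of [ln |f|] see [Re (D 0 / f 0)]. *)
Let weight (x : R) (z : C) : C := z * (x^-1)%:C + (z * (x^-1)%:C * (z * (x^-1)%:C) + 1) * (2^-1)%:C.

Let weight_circle (x t : R) : 0 < x -> weight x (x%:C * cis t) = (1 + cos t)%:C * cis t.
Proof.
move=> x0; rewrite /weight [x%:C * _ * _]mulrAC -rmorphM /= mulfV ?gt_eqF // mul1r.
apply/eqP; rewrite eq_complex /=; apply/andP; split; apply/eqP.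
  rewrite !(mulr0, mul0r, subr0, addr0, add0r).
  have := cos2Dsin2 t => cs.
  rewrite (_ : sin t * sin t = 1 - cos t * cos t); first by field.
  by rewrite -!expr2 -cs addrAC subrr add0r.
by field.
Qed.



Let weight_holo (x : R) (S : set C) (M : R) : (forall z, S z -> cmod z <= M) ->
  bounded_holo S (weight x).
Proof.
move=> SM; have hid : bounded_holo S (id : C -> C) by exact: bounded_holo_id SM.
pose a : C -> C := id * cst (x^-1)%:C.
have ha : bounded_holo S a := bounded_holoM hid (bounded_holo_cst _ _).
have -> : weight x = a + (a * a + cst 1) * cst (2^-1)%:C by exact/funext.
apply: (bounded_holoD ha); apply: bounded_holoM (bounded_holo_cst _ _).
exact: (bounded_holoD (bounded_holoM ha ha) (bounded_holo_cst _ _)).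
Qed.

Let weight_norm (x t : R) : 0 < x -> cmod (weight x (x%:C * cis t)) <= 2.
Proof.
move=> x0; rewrite weight_circle // cmodM cmod_cis mulr1 cmod_real.
by rewrite ger0_norm; have := cos_geN1 t; have := cos_le1 t; lra.
Qed.

Let L_ge0 : 0 < rho -> 0 <= L.
Proof.
move=> r0; have r2 : 0 <= rho / 2 by rewrite divr_ge0 // ltW.
have hr : cmod (rho / 2)%:C < rho.
  by rewrite cmod_real ger0_norm // ltr_pdivrMr // mulr2n mulrDr mulr1 ltrDl.
have h0 : cmod (0 : C) < rho by rewrite cmod0.
have := le_trans (cmod_ge0 _) (DL hr h0).
by rewrite subr0 cmod_real ger0_norm // pmulr_lge0 // divr_gt0.
Qed.

(* [D] is not known to be derivable, so the mean value property is applied to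
   the difference quotients [Q e] of [f] instead, and [e] tends to [0]. *)
Lemma log_derivative_mean (x : R) : 0 < x < rho ->
  \int[mu]_(t in `[0, pi *+ 2])
    complex.Re (D (x%:C * cis t) / f (x%:C * cis t) * weight x (x%:C * cis t)) =
  complex.Re (D 0 / f 0) * pi.
Proof.
move=> /andP[x0 xr].
have r0 : 0 < rho := lt_trans x0 xr.
have L0 := L_ge0 r0.
have pi0 : 0 < pi :> R := pi_gt0 R.
have zx t : cmod (x%:C * cis t) = x by rewrite cmod_circle // ltW.
have z0 : cmod (0 : C) < rho by rewrite cmod0.
pose H z := D z / f z * weight x z.
have cH : continuous (fun t => complex.Re (H (x%:C * cis t))).
  apply: continuous_Re_circle => t.
  have zr : cmod (x%:C * cis t) < rho by rewrite zx.
  have cf : {for x%:C * cis t, continuous f}.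
    by have [d _] := fd zr; exact: (differentiable_continuous ((derivable1_diffP _ _).1 d)).
  have fn : f (x%:C * cis t) != 0 by exact: f_neq0.
  move: (x%:C * cis t) zr cf fn => z zr cf fn.
  have cD := D_continuous zr.
  have cw : {for z, continuous (weight x)}.
    have [|M /(_ z) [|dw _ _]] := @weight_holo x [set z | cmod z < rho] rho; first by move=> y /ltW.
      exact: zr.
    exact: (differentiable_continuous ((derivable1_diffP _ _).1 dw)).
  exact: (continuousM (continuousM cD (continuousV fn cf)) cw).
(* Since [x + 2 d = rho], the disc of radius [x + d] contains the circle of radius [x] and still
   lies inside the domain after a shift by [e <= d]. *)
pose d := (rho - x) / 2.
have d0 : 0 < d by rewrite divr_gt0 // subr_gt0.
pose Q (e : R) z := (f (z + e%:C) - f z) * (e^-1)%:C * (f z)^-1 * weight x z.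
have e_norm (e : R) : 0 < e -> cmod e%:C = e by move=> e0; rewrite cmod_real gtr0_norm.
have inb z e : 0 < e <= d -> cmod z < x + d -> cmod z + cmod e%:C < rho.
  move=> /andP[e0 ed] zx1; rewrite e_norm //; have := ltr_leD zx1 ed.
  by rewrite /d; lra.
have inb1 z : cmod z < x + d -> cmod z < rho.
  by move=> /lt_trans; apply; rewrite /d; lra.
have HQ e : 0 < e <= d -> bounded_holo [set z | cmod z < x + d] (Q e).
  move=> ed.
  have hf : bounded_holo [set z | cmod z < x + d] f by apply: bounded_holo_sub fholo => z /inb1.
  apply: (@bounded_holoM _ _ (fun z => (f (z + e%:C) - f z) * (e^-1)%:C * (f z)^-1) (weight x)).
    apply: (@bounded_holoM _ _ (fun z => (f (z + e%:C) - f z) * (e^-1)%:C) (fun z => (f z)^-1)).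
      apply: (@bounded_holoM _ _ (fun z => (f (z + e%:C) - f z)) (cst (e^-1)%:C)).
        apply: (@bounded_holoD _ _ (fun z => f (z + e%:C)) (- f)); last exact: bounded_holoN.
        apply: bounded_holo_shift; apply: bounded_holo_sub fholo => _ [z zx1 <-].
        by apply: (le_lt_trans (cmodD _ _)); exact: inb.
      exact: bounded_holo_cst.
    apply: (bounded_holoV ltr01) => //.
    by move=> z /inb1; exact: f1.
  by apply: (@weight_holo x _ (x + d)) => z /ltW.
have mQ e : 0 < e <= d ->
    \int[mu]_(t in `[0, pi *+ 2]) complex.Re (Q e (x%:C * cis t)) =
    complex.Re (Q e 0) * (pi *+ 2).
  by move=> ed; apply: (mean_value_disc _ (HQ e ed)); rewrite x0 ltrDl.
have cQ e : 0 < e <= d -> continuous (fun t => complex.Re (Q e (x%:C * cis t))).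
  move=> ed; apply: circle_continuous => t; have [M HM] := HQ e ed.
  by have [|dQ _ _] := HM (x%:C * cis t); [rewrite /= zx ltrDl|exact: dQ].
have quot z e : 0 < e <= d -> cmod z < x + d ->
    cmod (D z / f z - (f (z + e%:C) - f z) * (e^-1)%:C * (f z)^-1) <= L * e.
  move=> ed zxd; have /andP[e0 _] := ed.
  rewrite -mulrBl cmodM cmodV cmodB fmorphV /=.
  have en0 : e%:C != 0 :> C by rewrite -cmod_eq0 e_norm // gt_eqF.
  have := difference_quotient_dist en0 (inb _ _ ed zxd).
  rewrite e_norm // => Hq; rewrite -[leRHS]mulr1 ler_pM ?cmod_ge0 ?invr_ge0 ?cmod_ge0 //.
  by rewrite invf_le1 ?f1 ?inb1 // (lt_le_trans ltr01) // f1 // inb1.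
apply/eqP; rewrite -subr_eq0 -normr_le0; apply/ler_addgt0Pl => e' e'0; rewrite addr0.
(* The error is at most [4 L pi e] on the circle, where the weight is at most [2], and at most
   [2 L pi e] at the centre. The [+ 1] keeps the denominator positive when [L = 0]. *)
have c0 : 0 < 6 * L * pi + 1 by rewrite ltr_wpDl // mulr_ge0 ?mulr_ge0 // ltW.
pose e := Num.min d (e' / (6 * L * pi + 1)).
have ed : 0 < e <= d by rewrite lt_min d0 divr_gt0 //= ge_min lexx.
have ee' : 6 * L * pi * e <= e'.
  have : e <= e' / (6 * L * pi + 1) by rewrite ge_min lexx orbT.
  rewrite ler_pdivlMr // mulrDr mulr1 mulrC; apply: le_trans.
  by rewrite lerDl ltW //; case/andP: ed.
apply: le_trans ee'.
have -> : \int[mu]_(t in `[0, pi *+ 2]) complex.Re (H (x%:C * cis t)) - complex.Re (D 0 / f 0) * pi =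
    \int[mu]_(t in `[0, pi *+ 2]) (complex.Re (H (x%:C * cis t)) - complex.Re (Q e (x%:C * cis t)))
    + (complex.Re (Q e 0) * (pi *+ 2) - complex.Re (D 0 / f 0) * pi).
  rewrite RintegralB //; first last.
  - by apply: continuous_integrable; exact: cQ.
  - exact: continuous_integrable.
  by rewrite mQ // addrA subrK.
have -> : 6 * L * pi * e = (L * e * 2) * (pi *+ 2) + L * e * 2 * pi by ring.
apply: (le_trans (ler_normD _ _)); apply: lerD.
  apply: Rintegral_circle_bound.
    by move=> t; apply: cvgB; [exact: cH|exact: cQ].
  move=> t; rewrite -ReB /H /Q -mulrBl (le_trans (normRe_le_cmod _)) // cmodM.
  by rewrite ler_pM ?cmod_ge0 ?weight_norm ?quot // zx ltrDl.
(* The weight equals [1/2] at the centre, which turns the factor [2 pi] into [pi]. *)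
have -> : complex.Re (Q e 0) * (pi *+ 2) - complex.Re (D 0 / f 0) * pi =
   complex.Re ((f (0 + e%:C) - f 0) * (e^-1)%:C * (f 0)^-1 - D 0 / f 0) * pi.
  rewrite /Q /weight !mul0r !add0r mul1r [_ * 2^-1%:C]mulrC Re_realM ReB; by field.
rewrite normrM (gtr0_norm pi0) ler_pM2r // (le_trans (normRe_le_cmod _)) //.
rewrite cmodB (le_trans (quot _ _ ed _)) //; first by rewrite cmod0 addr_gt0.
by rewrite ler_peMr ?mulr_ge0 ?ler1n // ltW //; case/andP: ed.
Qed.

(** The infinitesimal form of Harnack's inequality. The weighted average [J x] of [ln |f|] on the
    circle of radius [x] has the constant slope [pi * Re (D 0 / f 0)] by [log_derivative_mean],
    starts at [2 pi * ln |f 0|], and is nonnegative at [x = r] because [ln |f|] and [1 + cos t]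
    are. *)
Lemma log_gradient_bound (r : R) : 0 < r < rho ->
  - (r * complex.Re (D 0 / f 0)) <= 2 * ln (cmod (f 0)).
Proof.
move=> /andP[r0 rr]; have rho0 : 0 < rho := lt_trans r0 rr.
have pi0 : 0 < pi :> R := pi_gt0 R.
have pi2 : 0 < pi *+ 2 :> R by rewrite pmulrn_lgt0.
have I_norm (x t : R) : x \in `]-rho, rho[ -> cmod (x%:C * cis t) < rho.
  by rewrite in_itv /= cmodM cmod_real cmod_cis mulr1 ltr_norml.
pose F (x t : R) := ln (cmod (f (x%:C * cis t))) * (1 + cos t).
pose G (x t : R) := complex.Re (D (x%:C * cis t) * cis t / f (x%:C * cis t)) * (1 + cos t).
have dF (x t : R) : x \in `]-rho, rho[ -> is_derive x 1 (F ^~ t) (G x t).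
  move=> /I_norm - /(_ t) xr; have dfx := fd xr.
  have [d1 d2] := is_derive_ray x t.
  have e1 := is_derive_Re_comp dfx d1 d2; have e2 := is_derive_Im_comp dfx d1 d2.
  have X := is_deriveZ (1 + cos t) (is_derive_ln_cmod (f_neq0 xr) e1 e2).
  rewrite (_ : F ^~ t = (1 + cos t) \*: (fun x => ln (cmod (f (x%:C * cis t))))).
    by rewrite /G mulrC; exact: X.
  by apply/funext => y; rewrite /F mulrC.
have cF x : x \in `]-rho, rho[ -> continuous (F x).
  move=> xI t; have xr := I_norm x t xI; have dfx := fd xr.
  have [d1 d2] := is_derive_circle x t.
  have e1 := is_derive_Re_comp dfx d1 d2; have e2 := is_derive_Im_comp dfx d1 d2.
  have := is_derive_continuous (is_derive_ln_cmod (f_neq0 xr) e1 e2) => c1.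
  apply: (continuousM c1); apply: continuousD; first exact: cst_continuous.
  exact: continuous_cos.
have K0 : 0 <= K.
  by apply: le_trans (DK (z := 0) _); rewrite ?cmod_ge0 // cmod0.
have GK x t : x \in `]-rho, rho[ -> `|G x t| <= K * 2.
  move=> /I_norm - /(_ t) xr; rewrite normrM ler_pM //.
    rewrite (le_trans (normRe_le_cmod _)) // 2!cmodM cmod_cis mulr1 cmodV.
    rewrite -[leRHS]mulr1 ler_pM ?cmod_ge0 ?invr_ge0 ?cmod_ge0 ?DK //.
    by rewrite invf_le1 ?f1 // (lt_le_trans ltr01) // f1.
  by rewrite ger0_norm; have := cos_geN1 t; have := cos_le1 t; lra.
pose J (x : R) := \int[mu]_(t in `[0, pi *+ 2]) F x t.
(* The interval includes [0] so that [J] is continuous at the left end of [[0, r]]; the slope itself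
   is evaluated only for [x > 0], as the weight divides by [x]. *)
have dJ x : x \in `]-rho, rho[ ->
    derivable J x 1 /\ derive1 J x = \int[mu]_(t in `[0, pi *+ 2]) G x t.
  move=> xI.
  have Fint y : (`]-rho, rho[%classic : set R) y ->
      mu.-integrable `[0, pi *+ 2] (EFin \o F y).
    by move=> yI; apply: continuous_integrable; exact: cF.
  have dF1 y t : (`]-rho, rho[%classic : set R) y ->
    (`[0, pi *+ 2]%classic : set R) t -> derivable (F ^~ t) y 1.
    by move=> Iy _; have [] := dF y t Iy.
  have K20 : 0 <= K * 2 by rewrite mulr_ge0.
  have Kint : mu.-integrable `[0, pi *+ 2] (EFin \o cst (K * 2)).
    by apply: continuous_integrable => y; exact: cst_continuous.
  have bnd y t : (`]-rho, rho[%classic : set R) y ->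
      (`[0, pi *+ 2]%classic : set R) t -> `|partial1of2 F y t| <= cst (K * 2) t.
    by move=> Iy _; rewrite partial1of2E; have [_ ->] := dF y t Iy; exact: GK.
  have D1 := @derivable_under_integral R _ _ mu F `[0, pi *+ 2]%classic
    (measurable_itv _) x (- rho) rho xI Fint dF1 (cst (K * 2)) (fun=> K20) Kint bnd.
  have D2 := @differentiation_under_integral R _ _ mu F `[0, pi *+ 2]%classic
    (measurable_itv _) x (- rho) rho xI Fint dF1 (cst (K * 2)) (fun=> K20) Kint bnd.
  split; first exact: D1.
  apply: (etrans D2); apply: eq_Rintegral => t _.
  by rewrite partial1of2E; have [_ ->] := dF x t xI.
have dJ' (x : R) : 0 < x < rho -> is_derive x 1 J (complex.Re (D 0 / f 0) * pi).
  move=> /andP[x0 xr]; have [|d1 d2] := dJ x; first by rewrite in_itv /= xr (lt_trans _ x0) // oppr_lt0.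
  apply: DeriveDef; first exact: d1.
  rewrite -derive1E d2 -(log_derivative_mean (x := x)) ?x0 //.
  apply: eq_Rintegral => t _; rewrite weight_circle // /G mulrC -Re_realM; congr complex.Re.
  by rewrite mulrACA; ring.
have J0 : J 0 = ln (cmod (f 0)) * (pi *+ 2).
  have ccos : continuous (@cos R) := @continuous_cos R.
  have cone : continuous (fun _ : R => 1 : R) by move=> t; exact: cvg_cst.
  transitivity (\int[mu]_(t in `[0, pi *+ 2]) (ln (cmod (f 0)) * (1 + cos t))).
    by apply: eq_Rintegral => t _; rewrite /F mul0r.
  rewrite RintegralZl //; last first.
    by apply: continuous_integrable => t; apply: cvgD; [exact: cone|exact: ccos].
  rewrite RintegralD //; try exact: continuous_integrable.
  by rewrite Rintegral_cos addr0 Rintegral_cst //= lebesgue_measure_itv /= lte_fin pi2 /= subr0 mul1r.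
have Jr : 0 <= J r.
  apply: Rintegral_ge0 => t _; apply: mulr_ge0.
    by rewrite ln_ge0 // f1 // cmod_circle // ltW.
  by have := cos_geN1 t; lra.
have H1 (x : R) : x \in `]0, r[ -> is_derive x 1 J (complex.Re (D 0 / f 0) * pi).
  by rewrite in_itv /= => /andP[x0 xr]; apply: dJ'; rewrite x0 (lt_trans xr).
have H2 : {within `[0, r], continuous J}.
  apply: derivable_within_continuous => x; rewrite in_itv /= => /andP[x0 xr].
  have xI : x \in `]-rho, rho[ by rewrite in_itv /= (lt_le_trans _ x0) ?oppr_lt0 // (le_lt_trans xr).
  exact: (dJ x xI).1.
have [c _ E] := @MVT _ J (fun=> complex.Re (D 0 / f 0) * pi) 0 r r0 H1 H2.
have : 0 <= J 0 + complex.Re (D 0 / f 0) * pi * (r - 0) by rewrite -E addrC subrK.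
rewrite J0 subr0 (_ : _ + _ = (2 * ln (cmod (f 0)) + r * complex.Re (D 0 / f 0)) * pi).
  by rewrite pmulr_lge0 // -lerBlDr sub0r.
by ring.
Qed.

End Gradient.

End Harnack.

(** * Harnack's inequality on balls *)

Section LocalComparison.
Context {R : realType} {V : normedModType R[i]}.
Local Notation C := R[i].

Lemma is_derive_segment (f : V -> C) (w v : V) (t : R) :
  derivable f (w + t%:C *: v) v ->
  is_derive t 1 (fun x : R => complex.Re (f (w + x%:C *: v))) (complex.Re ('D_v f (w + t%:C *: v))) /\
  is_derive t 1 (fun x : R => complex.Im (f (w + x%:C *: v))) (complex.Im ('D_v f (w + t%:C *: v))).
Proof.
move=> df; have dl := is_derive_slice df.
have d1 : is_derive t 1 (fun x : R => complex.Re (x%:C : C)) (complex.Re (1 : C)).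
  exact: is_derive_id.
have d2 : is_derive t 1 (fun x : R => complex.Im (x%:C : C)) (complex.Im (1 : C)).
  exact: (is_derive_cst (0 : R)).
have e1 := is_derive_Re_comp dl d1 d2; have e2 := is_derive_Im_comp dl d1 d2.
by move: e1 e2; rewrite mulr1.
Qed.

Lemma ball_harnack_gradient (f : V -> C) (z0 w v : V) (rho B K : R) : 0 < rho ->
  (forall w, rnorm (w - z0) < rho *+ 2 ->
    [/\ forall v, derivable f w v, cmod (f w) <= B & forall v, cmod ('D_v f w) <= K * rnorm v]) ->
  (forall w, rnorm (w - z0) < rho -> 1 <= cmod (f w)) ->
  rnorm (w - z0) < rho / 2 -> rnorm v < rho ->
  - complex.Re ('D_v f w / f w) <= 8 * ln (cmod (f w)).
Proof.
move=> rho0 fb f1 hw hv.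
have hw1 : rnorm (w - z0) < rho by rewrite (lt_trans hw) // ltr_pdivrMr // mulr2n mulrDr mulr1 ltrDl.
have inb (z : C) : cmod z < 2^-1 -> rnorm (w + z *: v - z0) < rho.
  move=> hz; rewrite addrAC (le_lt_trans (rnormD _ _)) // [ltRHS]splitr ltr_leD // rnormZ.
  by rewrite [leRHS]mulrC ler_pM ?cmod_ge0 ?rnorm_ge0 // ltW.
have dbl u : rnorm (u - z0) < rho -> rnorm (u - z0) < rho *+ 2.
  by move=> /lt_trans; apply; rewrite mulr2n ltrDl.
pose F (z : C) := f (w + z *: v); pose D (z : C) := 'D_v f (w + z *: v).
have dF z : cmod z < 2^-1 -> is_derive z (1 : C) F (D z).
  by move=> /inb /dbl /fb[dv _ _]; exact: is_derive_slice.
have F1 z : cmod z < 2^-1 -> 1 <= cmod (F z) by move=> /inb /f1.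
have FB z : cmod z < 2^-1 -> cmod (F z) <= B by move=> /inb /dbl /fb[].
have DK z : cmod z < 2^-1 -> cmod (D z) <= K * rnorm v.
  by move=> /inb /dbl /fb[_ _ Kv]; exact: Kv.
have DL z y : cmod z < 2^-1 -> cmod y < 2^-1 ->
    cmod (D z - D y) <= 4 * K / rho * rnorm v * rnorm v * cmod (z - y).
  move=> /inb hz /inb hy; apply: (le_trans (ball_derive_lipschitz rho0 fb v hz hy)).
  rewrite (_ : w + z *: v - (w + y *: v) = (z - y) *: v).
    by rewrite rnormZ le_eqVlt; apply/orP; left; apply/eqP; ring.
  by rewrite opprD addrACA subrr add0r scalerBl.
(* The slice through [w] in the direction [v] maps the disc of radius [1/2] into the ball; radius
   [1/4] in [log_gradient_bound] gives the constant [8 = 2 * 4]. *)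
have r4 : 0 < (4^-1 : R) < 2^-1 by apply/andP; split; lra.
have := log_gradient_bound dF F1 FB DK DL r4.
rewrite {DL DK FB F1 dF} /F /D scale0r addr0.
move: (complex.Re _) (ln _) => a b; lra.
Qed.

(** On the segment from [w] to [w'], [U = ln |f|] satisfies [U' + 8 U >= 0], so [U t * expR (8 t)]
    is nondecreasing. The constant involves neither [B] nor [K]. *)
Lemma ball_harnack (f : V -> C) (z0 w w' : V) (rho B K : R) : 0 < rho ->
  (forall w, rnorm (w - z0) < rho *+ 2 ->
    [/\ forall v, derivable f w v, cmod (f w) <= B & forall v, cmod ('D_v f w) <= K * rnorm v]) ->
  (forall w, rnorm (w - z0) < rho -> 1 <= cmod (f w)) ->
  rnorm (w - z0) < rho / 2 -> rnorm (w' - z0) < rho / 2 ->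
  ln (cmod (f w)) <= expR 8 * ln (cmod (f w')).
Proof.
move=> rho0 fb f1 hw hw'.
pose v := w' - w.
have vrho : rnorm v < rho.
  rewrite (_ : v = (w' - z0) - (w - z0)); last by rewrite opprB addrA subrK.
  by apply: (le_lt_trans (rnormD _ _)); rewrite rnormN [rho]splitr ltrD.
have wv : w + v = w' by rewrite addrC subrK.
have inb (t : R) : 0 <= t <= 1 -> rnorm (w + t%:C *: v - z0) < rho / 2.
  by move=> t01; apply: ball_segment => //; rewrite wv.
have half u : rnorm (u - z0) < rho / 2 -> rnorm (u - z0) < rho.
  by move=> /lt_trans; apply; rewrite ltr_pdivrMr // mulr2n mulrDr mulr1 ltrDl.
have dbl u : rnorm (u - z0) < rho -> rnorm (u - z0) < rho *+ 2.
  by move=> /lt_trans; apply; rewrite mulr2n ltrDl.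
pose U (t : R) := ln (cmod (f (w + t%:C *: v))).
pose U' (t : R) := complex.Re ('D_v f (w + t%:C *: v) / f (w + t%:C *: v)).
have dU (t : R) : 0 <= t <= 1 -> is_derive t 1 U (U' t).
  move=> t01; have ht := half _ (inb t t01).
  have [dv _ _] := fb _ (dbl _ ht).
  have [d1 d2] := is_derive_segment (dv v).
  apply: is_derive_ln_cmod => //.
  by have := f1 _ ht; apply: contraTneq => ->; rewrite cmod0 -ltNge.
have UU' t : 0 <= t <= 1 -> 0 <= U' t + 8 * U t.
  move=> t01; have := ball_harnack_gradient rho0 fb f1 (inb t t01) vrho.
  by rewrite -lerBlDl sub0r.
pose g (t : R) := U t * expR (8 * t).
pose g' (t : R) := (U' t + 8 * U t) * expR (8 * t).
have dg (t : R) : 0 <= t <= 1 -> is_derive t 1 g (g' t).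
  move=> /dU dUt.
  have d8 : is_derive t 1 (fun x : R => expR (8 * x)) (expR (8 * t) * 8).
    apply: (@is_derive1_comp _ expR (fun x => 8 * x)).
    by apply: (is_derive_eq (is_deriveZ (8 : R) (is_derive_id t (1:R)))); exact: mulr1.
  apply: (is_derive_eq (is_deriveM dUt d8)).
  rewrite /g' -2![_ *: _]/(_ * _); ring.
have H1 (t : R) : t \in `]0, 1[ -> is_derive t 1 g (g' t).
  by rewrite in_itv /= => /andP[t0 t1]; apply: dg; rewrite !ltW.
have H2 : {within `[0, 1], continuous g}.
  apply: derivable_within_continuous => t; rewrite in_itv /= => t01.
  by have [d _] := dg t t01; exact: d.
have [c c01 E] := @MVT _ g g' 0 1 ltr01 H1 H2.
have : 0 <= g 1 - g 0.
  rewrite E subr0 mulr1 mulr_ge0 ?expR_ge0 // UU' //.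
  by move: c01; rewrite in_itv /= => /andP[c0 c1]; rewrite !ltW.
by rewrite subr_ge0 /g /U mulr0 expR0 mulr1 scale0r addr0 scale1r wv mulr1 [_ * expR _]mulrC.
Qed.

End LocalComparison.

(** * The two local regimes *)

Section Regimes.
Context {R : realType} {V : normedModType R[i]}.
Local Notation C := R[i].

(** Trades the real exponent [s] for an integer power of [1 + |f|^2], the quantity that is
    differentiated below. *)
Lemma powR_le_pow (x s : R) (p : nat) : 0 <= x -> 0 <= s -> s <= p%:R ->
  x `^ s <= (1 + x ^+ 2) ^+ p.
Proof.
move=> x0 s0 sp; have x2 : 0 <= x ^+ 2 by exact: sqr_ge0.
have [x1|/ltW x1] := leP x 1.
  apply: (@le_trans _ _ 1); last by rewrite exprn_ege1 // lerDl.
  apply: (@le_trans _ _ (1 `^ s)); last by rewrite powR1.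
  by apply: ge0_ler_powR; rewrite ?nnegrE.
apply: (le_trans (ler_powR x1 sp)); rewrite powR_mulrn // lerXn2r ?nnegrE ?addr_ge0 //.
apply: (@le_trans _ _ (x ^+ 2)); last by rewrite lerDr.
by rewrite expr2 ler_peMr.
Qed.

Definition gradient_bound (f : V -> C) (z0 : V) (r M s : R) :=
  forall w, rnorm (w - z0) < r -> (forall v, derivable f w v) /\
    forall v, cmod ('D_v f w) <= M * rnorm v * (1 + cmod (f w) `^ s).

Lemma is_derive_inv_pow (N : R -> R) (t N' : R) (p : nat) : 0 < N t -> is_derive t 1 N N' ->
  is_derive t 1 (fun x => (N x ^+ p.+1)^-1) (- (p.+1%:R * N' / N t ^+ p.+2)).
Proof.
move=> Nt dN; have NX := is_deriveX p.+1 dN.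
have Np : (N ^+ p.+1) t != 0 by rewrite fctE gt_eqF // exprn_gt0.
have X := is_deriveV Np NX.
rewrite (_ : (fun x => _) = (fun x => ((N ^+ p.+1) x)^-1)); last first.
  by apply/funext => x; rewrite fctE.
apply: (is_derive_eq X).
rewrite -2![_ *: _]/(_ * _) fctE /= !exprS.
have Nn : N t != 0 by rewrite gt_eqF.
have Npn : N t ^+ p != 0 by rewrite expf_neq0.
by rewrite expr0 mulr1; field; rewrite Npn Nn.
Qed.

Lemma cmod_ReIm_dot (a b : C) :
  `|complex.Re a * complex.Re b + complex.Im a * complex.Im b| <= cmod a * cmod b.
Proof.
have -> : complex.Re a * complex.Re b + complex.Im a * complex.Im b = complex.Re (a^*%C * b).
  by case: a => x y; case: b => u v /=; rewrite mulNr opprK.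
have -> : cmod a = cmod a^*%C by rewrite /cmod normcJ.
by rewrite -cmodM normRe_le_cmod.
Qed.

(** With [N = 1 + |f|^2] and [q = p + 1], the derivative of [N^-q] along the segment is
    [q |N'| / N^(q+1)] in absolute value. Here [|N'| <= 2 |f| |f'|], where [2 |f| <= N] and
    [|f'| <= M |v| (1 + |f|^s) <= 2 M |v| N^q], so all powers of [N] cancel. *)
Lemma inv_pow_lipschitz (f : V -> C) (z0 w : V) (r M s : R) (p : nat) :
  0 <= M -> 0 <= s -> s <= p.+1%:R -> gradient_bound f z0 r M s -> rnorm (w - z0) < r ->
  `|((1 + cmod (f w) ^+ 2) ^+ p.+1)^-1 - ((1 + cmod (f z0) ^+ 2) ^+ p.+1)^-1|
    <= 2 * p.+1%:R * M * rnorm (w - z0).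
Proof.
move=> M0 s0 sp gb wr; set v := w - z0.
have r0 : 0 < r by apply: le_lt_trans wr; exact: rnorm_ge0.
have inb (t : R) : 0 <= t <= 1 -> rnorm (z0 + t%:C *: v - z0) < r.
  by move=> t01; apply: ball_segment => //; rewrite ?subrr ?rnorm0 // /v addrCA subrr addr0.
pose h (t : R) := f (z0 + t%:C *: v); pose h' (t : R) := 'D_v f (z0 + t%:C *: v).
pose N (t : R) := 1 + (complex.Re (h t) * complex.Re (h t) + complex.Im (h t) * complex.Im (h t)).
have NE t : N t = 1 + cmod (h t) ^+ 2 by rewrite /N -!expr2 -cmod_sqr.
have N1 t : 1 <= N t by rewrite NE lerDl sqr_ge0.
pose N' (t : R) := 2 * (complex.Re (h t) * complex.Re (h' t) + complex.Im (h t) * complex.Im (h' t)).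
have dN (t : R) : 0 <= t <= 1 -> is_derive t 1 N (N' t).
  move=> t01; have [dv _] := gb _ (inb t t01).
  have [d1 d2] := is_derive_segment (dv v).
  have X := is_deriveD (is_derive_cst (1 : R) t 1) (is_deriveD (is_deriveM d1 d1) (is_deriveM d2 d2)).
  apply: (is_derive_eq X); rewrite /N' add0r -/(h t) -/(h' t) -![_ *: _]/(_ * _); ring.
have N'b t : 0 <= t <= 1 -> `|N' t| <= 2 * M * rnorm v * (N t * N t ^+ p.+1).
  move=> t01; have [_ /(_ v) hM] := gb _ (inb t t01).
  rewrite /N' normrM ger0_norm //.
  apply: (@le_trans _ _ (2 * (cmod (h t) * cmod (h' t)))).
    by rewrite ler_wpM2l // cmod_ReIm_dot.
  have hp := powR_le_pow (cmod_ge0 (h t)) s0 sp; rewrite -NE in hp.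
  have Np1 : 1 <= N t ^+ p.+1 by rewrite exprn_ege1.
  have hN : 2 * cmod (h t) <= N t.
    by rewrite NE -subr_ge0 (_ : _ - _ = (cmod (h t) - 1) ^+ 2); [exact: sqr_ge0|ring].
  have h'N : cmod (h' t) <= M * rnorm v * (2 * N t ^+ p.+1).
    apply: (le_trans hM); rewrite ler_wpM2l ?mulr_ge0 ?rnorm_ge0 //.
    by rewrite mulr2n mulrDl mul1r lerD.
  rewrite mulrA (le_trans (ler_pM _ _ hN h'N)) ?mulr_ge0 ?cmod_ge0 //.
  by rewrite le_eqVlt; apply/orP; left; apply/eqP; ring.
pose W (t : R) := (N t ^+ p.+1)^-1.
pose W' (t : R) := - (p.+1%:R * N' t / N t ^+ p.+2).
have N0 t : 0 < N t by exact: lt_le_trans (N1 t).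
have dW (t : R) : 0 <= t <= 1 -> is_derive t 1 W (W' t).
  by move=> /dN dNt; exact: is_derive_inv_pow.
have H1 (t : R) : t \in `]0, 1[ -> is_derive t 1 W (W' t).
  by rewrite in_itv /= => /andP[t0 t1]; apply: dW; rewrite !ltW.
have H2 : {within `[0, 1], continuous W}.
  apply: derivable_within_continuous => t; rewrite in_itv /= => t01.
  by have [d _] := dW t t01; exact: d.
have [c c01 E] := @MVT _ W W' 0 1 ltr01 H1 H2.
have {c01}c01 : 0 <= c <= 1 by move: c01; rewrite in_itv /= => /andP[c0 c1]; rewrite !ltW.
have h1 : h 1 = f w by rewrite /h scale1r /v addrCA subrr addr0.
have h0 : h 0 = f z0 by rewrite /h scale0r addr0.
rewrite -h1 -h0 -!NE -/(W 1) -/(W 0) E subr0 mulr1 /W' normrN normrM normfV.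
have Nc : 0 < N c ^+ p.+2 by rewrite exprn_gt0.
rewrite (gtr0_norm Nc) ler_pdivrMr //.
rewrite normrM ger0_norm // (le_trans (ler_wpM2l _ (N'b c c01))) //.
by rewrite -exprS le_eqVlt; apply/orP; left; apply/eqP; ring.
Qed.

End Regimes.

Section TwoRegimes.
Context {R : realType} {V : normedModType R[i]}.
Local Notation C := R[i].

Lemma two_regimes (M s r : R) : 0 < r -> 0 <= M -> 0 <= s ->
  exists2 d, 0 < d <= r & exists A : R, forall (f : V -> C) z0, gradient_bound f z0 r M s ->
    (forall w, rnorm (w - z0) < d -> 1 <= cmod (f w)) \/
    (forall w, rnorm (w - z0) < d -> cmod (f w) <= A).
Proof.
move=> r0 M0 s0.
have [p sp] : exists p, s <= p.+1%:R.
  exists (Num.bound s); have := archi_boundP s0 => sb.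
  by rewrite (le_trans (ltW sb)) // ler_nat.
(* The value of [N^-(p+1)] at the threshold [N = 4]. The radius below is chosen so that [N^-(p+1)]
   varies by at most [c / 2]. *)
pose c : R := (4 ^+ p.+1)^-1.
have c0 : 0 < c by rewrite invr_gt0 exprn_gt0.
pose K : R := 2 * p.+1%:R * M + 1.
have K0 : 0 < K by rewrite ltr_wpDl // !mulr_ge0.
exists (Num.min r (c / 2 / K)).
  by rewrite lt_min r0 !divr_gt0 //= ge_min lexx.
exists (2 * 4 ^+ p.+1) => f z0 gb.
pose N w := 1 + cmod (f w) ^+ 2.
have N1 w : 1 <= N w by rewrite lerDl sqr_ge0.
have N0 w : 0 <= N w by exact: le_trans (N1 w).
have Np w : 0 < N w ^+ p.+1 by rewrite exprn_gt0 // (lt_le_trans ltr01).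
have close w : rnorm (w - z0) < Num.min r (c / 2 / K) ->
    `|(N w ^+ p.+1)^-1 - (N z0 ^+ p.+1)^-1| <= c / 2.
  rewrite lt_min => /andP[wr]; rewrite ltr_pdivlMr // mulrC => /ltW wc.
  apply: le_trans wc; apply: (le_trans (inv_pow_lipschitz M0 s0 sp gb wr)).
  by rewrite ler_wpM2r ?rnorm_ge0 // lerDl.
(* If [N z0 >= 4], then [N^-(p+1)] stays below [2 c <= 2^-(p+1)], so [N >= 2] and [|f| >= 1].
   Otherwise it stays above [c / 2], so [|f| <= N <= N^(p+1) <= 2 * 4^(p+1)]. *)
have [N4|/ltW N4] := leP 4 (N z0); [left|right] => w /close; rewrite ler_norml => /andP[h1 h2].
  have h0 : (N z0 ^+ p.+1)^-1 <= c.
    rewrite /c lef_pV2 ?posrE ?Np ?exprn_gt0 // lerXn2r ?nnegrE // N0.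
  have : (N w ^+ p.+1)^-1 <= (2 ^+ p.+1)^-1.
    apply: (@le_trans _ _ (2 * c)); first by move: h0 h2 c0; clear; lra.
    rewrite /c -ler_pdivlMl // -invfM lef_pV2 ?posrE ?mulr_gt0 ?exprn_gt0 //.
    rewrite (_ : 4 = 2 * 2); last by rewrite -natrM.
    by rewrite exprMn ler_wpM2r ?exprn_ge0 // exprS ler_peMr // exprn_ege1 // ler1n.
  rewrite lef_pV2 ?posrE ?Np ?exprn_gt0 // ler_pXn2r ?nnegrE ?N0 //.
  rewrite -lerBlDl (_ : 2 - 1 = 1); last by ring.
  by rewrite -[X in X <= _](expr1n _ 2) ler_pXn2r ?nnegrE ?cmod_ge0.
have h0 : c <= (N z0 ^+ p.+1)^-1.
  by rewrite /c lef_pV2 ?posrE ?Np ?exprn_gt0 // lerXn2r ?nnegrE // N0.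
have : (2 * 4 ^+ p.+1)^-1 <= (N w ^+ p.+1)^-1.
  by rewrite invfM -/c mulrC; move: h0 h1; clear; lra.
rewrite lef_pV2 ?posrE ?Np ?mulr_gt0 ?exprn_gt0 //; apply: le_trans.
apply: (@le_trans _ _ (N w)); last by rewrite exprS ler_peMr ?exprn_ege1 ?N0.
by rewrite /N; have := sqr_ge0 (cmod (f w) - 1); have := cmod_ge0 (f w); nra.
Qed.

(** The boundedness assumed of each [f] need not be uniform in [f]: it only makes [ball_harnack]
    applicable, whose constant does not see it. *)
Lemma local_comparison (F : set (V -> C)) (z0 : V) (r M s : R) : 0 < r -> 0 <= M -> 0 <= s ->
  (forall f, F f -> gradient_bound f z0 r M s) ->
  (forall f, F f -> exists B, forall w, rnorm (w - z0) < r -> cmod (f w) <= B) ->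
  exists2 d, 0 < d <= r & forall A, exists B, forall f w w', F f ->
    rnorm (w - z0) < d -> rnorm (w' - z0) < d -> cmod (f w') <= A -> cmod (f w) <= B.
Proof.
move=> r0 M0 s0 Fgb Fbd.
have [d /andP[d0 dr] [A0 H]] := two_regimes r0 M0 s0.
(* Harnack is used on the ball of radius [d / 2], inside the two-regime ball of radius [d], and
   compares points of the ball of half that radius. *)
exists (d / 4); first by rewrite divr_gt0 //= (le_trans _ dr) // ler_pdivrMr // ler_peMr ?ler1n // ltW.
move=> A; exists (Num.max A0 (expR (expR 8 * ln A))) => f w w' Ff hw hw' fA.
have d4 : d / 4 < d by rewrite ltr_pdivrMr // ltr_pMr // ltr1n.
rewrite le_max; apply/orP.
have [f1|fA0] := H f z0 (Fgb f Ff); [right|left]; last by apply: fA0; exact: lt_trans d4.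
have [B fB] := Fbd f Ff.
have fb u : rnorm (u - z0) < (d / 2) *+ 2 ->
    [/\ forall v, derivable f u v, cmod (f u) <= B &
     forall v, cmod ('D_v f u) <= M * (1 + B `^ s) * rnorm v].
  rewrite -mulr_natr divfK // => ud; have ur := lt_le_trans ud dr.
  have [df gf] := Fgb f Ff u ur.
  have uB := fB u ur.
  split; [exact: df|exact: uB|move=> v].
  apply: (le_trans (gf v)); rewrite mulrAC ler_wpM2r ?rnorm_ge0 // ler_wpM2l // lerD2l.
  by apply: ge0_ler_powR; rewrite ?nnegrE ?cmod_ge0 // (le_trans (cmod_ge0 _) uB).
have f1' u : rnorm (u - z0) < d / 2 -> 1 <= cmod (f u).
  by move=> ud; apply: f1; apply: (lt_trans ud); rewrite ltr_pdivrMr // ltr_pMr // ltr1n.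
have d20 : 0 < d / 2 by rewrite divr_gt0.
have E : d / 2 / 2 = d / 4 by rewrite -mulrA -invfM -natrM.
have := ball_harnack (w := w) (w' := w') d20 fb f1'; rewrite E => /(_ hw hw') Hn.
have p1 : 1 <= cmod (f w) by apply: f1; exact: lt_trans d4.
have p2 : 1 <= cmod (f w') by apply: f1; exact: lt_trans d4.
have q1 : 0 < cmod (f w) := lt_le_trans ltr01 p1.
have q2 : 0 < cmod (f w') := lt_le_trans ltr01 p2.
rewrite -[leLHS]lnK ?posrE // ler_expR (le_trans Hn) // ler_wpM2l ?expR_ge0 //.
by rewrite ler_ln ?posrE // (lt_le_trans q2).
Qed.

End TwoRegimes.

(** * The unit ball *)

Section UnitBall.
Context {R : realType} {n : nat}.
Local Notation C := R[i].
Local Notation Cn := 'rV[R[i]]_n.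
Implicit Types (z w v : Cn).

Lemma cmod_coord v i : cmod (v 0 i) <= rnorm v.
Proof.
rewrite -lecR -norm_cmod -rnormE.
rewrite [leRHS]mx_normE (_ : `|v 0 i| = (`|v 0 i|%:nng)%:num) // num_le.
exact: (le_bigmax _ (fun ij : 'I_1 * 'I_n => `|v ij.1 ij.2|%:nng) (0, i)).
Qed.

Lemma rnorm_le_coord v (e : R) : 0 <= e -> (forall i, cmod (v 0 i) <= e) -> rnorm v <= e.
Proof.
move=> e0 H; rewrite -lecR -rnormE; have [->|v0] := eqVneq `|v| 0; first by rewrite lecR.
have [[i j] /= E] := mx_norm_neq0 v0.
have -> : `|v| = `|v i j| by exact: E.
by rewrite ord1 norm_cmod lecR.
Qed.

Lemma unit_ballE z : unit_ball z <-> \sum_(i < n) cmod (z 0 i) ^+ 2 < 1.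
Proof.
by rewrite /unit_ball /enorm /= -[X in _ < X](@sqrtr1 R) ltr_sqrt ?ltr01 //.
Qed.

Lemma unit_ball_nbhs z : unit_ball z ->
  exists2 r : R, 0 < r & forall w, rnorm (w - z) <= r -> unit_ball w.
Proof.
move/unit_ballE; set S := \sum_(i < n) _ => S1.
have zi i : cmod (z 0 i) <= 1.
  rewrite -(@ler_pXn2r _ 2) ?nnegrE ?cmod_ge0 // expr1n (le_trans _ (ltW S1)) //.
  by rewrite /S (bigD1 i) //= lerDl sumr_ge0 // => j _; exact: sqr_ge0.
(* As [|z i| <= 1] and [r <= 1], replacing [|z i|] by [|z i| + r] adds at most [3 r] to the square,
   hence at most [3 n r] to the sum. *)
have N0 : 0 < 3 * n%:R + 1 :> R by rewrite ltr_wpDl // mulr_ge0.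
pose r := Num.min 1 ((1 - S) / (2 * (3 * n%:R + 1))).
have r0 : 0 < r by rewrite lt_min ltr01 divr_gt0 ?subr_gt0 // mulr_gt0.
have r1 : r <= 1 by rewrite ge_min lexx.
have rS : 3 * n%:R * r < 1 - S.
  have : r <= (1 - S) / (2 * (3 * n%:R + 1)) by rewrite ge_min lexx orbT.
  rewrite ler_pdivlMr ?mulr_gt0 // => h; apply: lt_le_trans h.
  have n0 : 0 <= n%:R :> R by [].
  have : 0 <= n%:R * r by rewrite mulr_ge0 // ltW.
  nra.
exists r => // w wz; apply/unit_ballE.
have wi i : cmod (w 0 i) ^+ 2 <= cmod (z 0 i) ^+ 2 + 3 * r.
  have h : cmod (w 0 i) <= cmod (z 0 i) + r.
    rewrite -[w](subrK z) mxE addrC (le_trans (cmodD _ _)) // lerD2l.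
    exact: le_trans (cmod_coord _ i) wz.
  apply: (@le_trans _ _ ((cmod (z 0 i) + r) ^+ 2)).
    by rewrite ler_pXn2r ?nnegrE ?addr_ge0 ?cmod_ge0 // ltW.
  by have := zi i; have := cmod_ge0 (z 0 i); nra.
apply: (@le_lt_trans _ _ (\sum_(i < n) (cmod (z 0 i) ^+ 2 + 3 * r))).
  by apply: ler_sum => i _; exact: wi.
rewrite big_split /= sumr_const card_ord -/S -ltrBrDl (le_lt_trans _ rS) //.
by rewrite -[_ *+ n]mulr_natr mulrAC.
Qed.

Lemma unit_ballZ z (t : R) : 0 <= t <= 1 -> unit_ball z -> unit_ball (t%:C *: z).
Proof.
move=> /andP[t0 t1] /unit_ballE H; apply/unit_ballE; apply: le_lt_trans H.
apply: ler_sum => i _; rewrite mxE cmodM cmod_real ger0_norm //.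
rewrite ler_pXn2r ?nnegrE ?mulr_ge0 ?cmod_ge0 //.
by rewrite ler_piMl ?cmod_ge0.
Qed.

Lemma continuous_ReIm : continuous (fun p : R * R => (p.1 +i* p.2 : C)).
Proof.
move=> p A /nbhs_rnormP[e e0 H].
have e20 : 0 < e / 2 by rewrite divr_gt0.
apply/nbhs_ballP; exists (e / 2) => //= q [h1 h2]; apply: H.
rewrite -[rnorm _]/(cmod _); apply: (le_lt_trans (cmod_le_ReIm _)) => /=.
by rewrite [e]splitr ltrD // distrC.
Qed.

(** Supplies the compact neighbourhoods on which the hypothesis of local boundedness is invoked. The
    factor [2] comes from bounding a modulus by the sum of the absolute values of the real and
    imaginary parts. *)
Lemma compact_polyrectangle z (r : R) : 0 <= r -> exists K : set Cn,
  [/\ compact K, forall w, rnorm (w - z) < r -> K w &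
      forall w, K w -> rnorm (w - z) <= 2 * r].
Proof.
move=> r0.
pose A (i : 'I_n) : set C := (fun p : R * R => (p.1 +i* p.2 : C)) @`
  (`[complex.Re (z 0 i) - r, complex.Re (z 0 i) + r]%classic `*`
   `[complex.Im (z 0 i) - r, complex.Im (z 0 i) + r]%classic).
exists [set v : Cn | forall i, A i (v 0 i)]; split.
- apply: rV_compact => i; apply: continuous_compact.
    by apply: continuous_subspaceT; exact: continuous_ReIm.
  by apply: compact_setX; exact: segment_compact.
- move=> w wz i; have := le_lt_trans (cmod_coord _ i) wz; rewrite !mxE => h.
  exists (complex.Re (w 0 i), complex.Im (w 0 i)); last by case: (w 0 i).
  have := le_trans (normRe_le_cmod _) (ltW h); have := le_trans (normIm_le_cmod _) (ltW h).
  rewrite ReB ImB !ler_norml => /andP[h1 h2] /andP[h3 h4].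
  by split; rewrite /= in_itv /=; apply/andP; split; lra.
- move=> w Aw; apply: rnorm_le_coord; first by rewrite mulr_ge0.
  move=> i; rewrite !mxE; have [[x y] [/= hx hy] <-] := Aw i.
  apply: (le_trans (cmod_le_ReIm _)); rewrite ReB ImB /=.
  rewrite (_ : 2 * r = r + r); last by ring.
  move: hx hy; rewrite !in_itv /= => /andP[h1 h2] /andP[h3 h4].
  by apply: lerD; rewrite ler_norml; apply/andP; split; lra.
Qed.

Lemma cmod_sum (a : 'I_n -> C) : cmod (\sum_i a i) <= \sum_i cmod (a i).
Proof.
elim/big_ind2 : _ => [|x y x' y' h h'|//]; first by rewrite cmod0.
by rewrite (le_trans (cmodD _ _)) // lerD.
Qed.

Lemma derive_coord (f : Cn -> C) w v : differentiable f w ->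
  'D_v f w = \sum_i v 0 i * cgrad f w 0 i.
Proof.
move=> df; rewrite (deriveE _ df) {1}(row_sum_delta v) linear_sum.
by apply: eq_bigr => i _; rewrite linearZ mxE (deriveE _ df).
Qed.

Lemma derive_coord_bound (f : Cn -> C) w v : differentiable f w ->
  cmod ('D_v f w) <= n%:R * rnorm v * enorm (cgrad f w).
Proof.
move=> df; rewrite (derive_coord _ df).
apply: (@le_trans _ _ (\sum_(i < n) rnorm v * enorm (cgrad f w))); last first.
  by rewrite sumr_const card_ord -[leLHS]mulr_natl mulrA.
apply: (le_trans (cmod_sum _)); apply: ler_sum => i _.
move: (cgrad f w) => g; rewrite cmodM ler_pM ?cmod_ge0 ?cmod_coord //.
rewrite /enorm -[leLHS](ger0_norm (cmod_ge0 _)) -sqrtr_sqr ler_wsqrtr //.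
by rewrite (bigD1 i) //= lerDl sumr_ge0 // => j _; exact: sqr_ge0.
Qed.

End UnitBall.

(** * Comparison along segments *)

Section Chain.
Context {R : realType}.
Local Notation C := R[i].

(** Connectedness of [[0, 1]]: the supremum of the points satisfying [P] inherits [P] from points
    just below it and, if less than [1], would pass it on to larger points. *)
Lemma real_continuation (P : R -> Prop) : P 0 ->
  (forall t, 0 <= t <= 1 -> exists2 d, 0 < d &
     forall s, 0 <= s <= 1 -> `|s - t| < d -> (P s <-> P t)) -> P 1.
Proof.
move=> P0 Ploc; pose E := [set t | 0 <= t <= 1 /\ P t].
have E0 : E 0 by rewrite /E /= lexx ler01.
have Eub : ubound E 1 by move=> t [/andP[]].
have hE : has_sup E by split; [exists 0|exists 1].
pose S := sup E.
have S0 : 0 <= S by apply: sup_upper_bound.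
have S1 : S <= 1 by apply: ge_sup => //; exists 0.
have [|d d0 H] := Ploc S; first by rewrite S0.
have [e [e01 Pe] Se] := sup_adherent d0 hE.
have eS : e <= S by apply: sup_upper_bound.
have PS : P S.
  by apply/(H e e01) => //; rewrite ler0_norm ?subr_le0 // opprB ltrBlDr -ltrBlDl.
have [S1'|S1'] := ltP S 1; last by rewrite (_ : 1 = S) //; apply/eqP; rewrite eq_le S1' S1.
pose t := Num.min 1 (S + d / 2).
have St : S < t by rewrite lt_min S1' ltrDl divr_gt0.
have t01 : 0 <= t <= 1 by rewrite (le_trans S0 (ltW St)) ge_min lexx.
have Pt : P t.
  apply/(H t t01) => //; rewrite gtr0_norm ?subr_gt0 // ltrBlDl.
  apply: (@le_lt_trans _ _ (S + d / 2)); first by rewrite ge_min lexx orbT.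
  by rewrite ltrD2l ltr_pdivrMr // ltr_pMr // ltr1n.
have : t <= S by apply: sup_upper_bound.
by rewrite leNgt St.
Qed.

Lemma cmod_continuous (T : topologicalType) (f : T -> C) (x : T) :
  {for x, continuous f} -> {for x, continuous (fun y => cmod (f y))}.
Proof.
move=> cf; apply/cvgrPdist_lt => e e0.
have /cvgrPdist_lt/(_ e%:C) := cf; rewrite ltcR => /(_ e0); apply: filterS => y.
rewrite norm_cmod ltcR; apply: le_lt_trans; rewrite ler_norml; apply/andP; split.
  by rewrite lerNl opprB lerBlDr cmodB -[f y in leLHS](subrK (f x)) cmodD.
by rewrite lerBlDr -[f x in leLHS](subrK (f y)) cmodD.
Qed.

End Chain.

(** * Estimates uniform over the family *)

Section Family.
Context {R : realType} {n : nat}.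
Local Notation C := R[i].
Local Notation Cn := 'rV[R[i]]_n.
Variables (F : set (Cn -> C)) (s : R).
Hypothesis s0 : 0 < s.
Hypothesis hF : forall f, F f -> holomorphic unit_ball f.
Hypothesis hG : locally_uniformly_bounded unit_ball
  [set (fun z => enorm (cgrad f z) / (1 + cmod (f z) `^ s)) | f in F].

Lemma family_local_data (z : Cn) : unit_ball z -> exists r M : R,
  [/\ 0 < r, 0 <= M, forall w, rnorm (w - z) < r -> unit_ball w,
      forall f, F f -> gradient_bound f z r M s &
      forall f, F f -> exists B, forall w, rnorm (w - z) < r -> cmod (f w) <= B].
Proof.
move=> /unit_ball_nbhs[r r0 Hr].
have r20 : 0 < r / 2 by rewrite divr_gt0.
have [K [cK rK Kr]] := compact_polyrectangle z (ltW r20).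
rewrite mulrC divfK // in Kr.
have KD : K `<=` unit_ball by move=> w /Kr /Hr.
have [M M0 HM] := hG cK KD.
exists (r / 2), (n%:R * M); split => //.
- by rewrite mulr_ge0 // ltW.
- by move=> w /rK /KD.
- move=> f Ff w /rK Kw; have df := hF Ff (KD _ Kw); split => v.
    exact: diff_derivable.
  apply: (le_trans (derive_coord_bound v df)).
  have /(_ w) := HM (fun z => enorm (cgrad f z) / (1 + cmod (f z) `^ s)).
  have p0 : 0 < 1 + cmod (f w) `^ s by rewrite ltr_pwDl // powR_ge0.
  move=> /(_ _ Kw); rewrite ler_pdivrMr // => h.
  have {}h : enorm (cgrad f w) <= M * (1 + cmod (f w) `^ s) by apply: h; exists f.
  apply: (le_trans (ler_wpM2l _ h)); first by rewrite mulr_ge0 // rnorm_ge0.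
  by rewrite le_eqVlt; apply/orP; left; apply/eqP; ring.
- move=> f Ff.
  have Kz : K !=set0 by exists z; apply: rK; rewrite subrr rnorm0.
  have cf : {within K, continuous (fun w => cmod (f w))}.
    apply: continuous_in_subspaceT => w; rewrite inE => Kw.
    apply: cmod_continuous.
    by apply: differentiable_continuous; exact: hF Ff _ (KD _ Kw).
  have [c _ Hc] := compact_EVT_max Kz cK cf.
  by exists (cmod (f c)) => w /rK Kw; apply: Hc; rewrite inE.
Qed.

Lemma family_comparison (z : Cn) : unit_ball z -> exists2 d : R, 0 < d &
  (forall w, rnorm (w - z) < d -> unit_ball w) /\
  forall A, exists B, forall f w w', F f ->
    rnorm (w - z) < d -> rnorm (w' - z) < d -> cmod (f w') <= A -> cmod (f w) <= B.
Proof.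
move=> /family_local_data[r [M [r0 M0 rD Fg FB]]].
have [d /andP[d0 dr] H] := local_comparison r0 M0 (ltW s0) Fg FB.
by exists d => //; split => // w wd; apply: rD; exact: lt_le_trans wd dr.
Qed.

(** Local comparison is chained along the segment from [0] to [z]. The first half turns boundedness
    at the origin into local boundedness, the second turns divergence at the origin into divergence
    everywhere. *)
Lemma family_comparison0 (z : Cn) (A : R) : unit_ball z ->
  (exists B, forall f, F f -> cmod (f 0) <= A -> cmod (f z) <= B) /\
  (exists B, forall f, F f -> cmod (f z) <= A -> cmod (f 0) <= B).
Proof.
move=> Dz; move: A.
(* The bounds [A] are quantified inside [P] because each step of the continuation changes them. *)
pose P t := (forall A, exists B, forall f, F f -> cmod (f 0) <= A -> cmod (f (t%:C *: z)) <= B) /\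
  (forall A, exists B, forall f, F f -> cmod (f (t%:C *: z)) <= A -> cmod (f 0) <= B).
suff : P 1 by rewrite /P scale1r => -[H1 H2] A; split.
apply: real_continuation.
  by rewrite /P scale0r; split=> A; exists A.
move=> t t01; have [d d0 [_ H]] := family_comparison (unit_ballZ t01 Dz).
exists (d / (rnorm z + 1)); first by rewrite divr_gt0 // ltr_wpDl // rnorm_ge0.
move=> y y01 yt.
have h1 : rnorm (y%:C *: z - t%:C *: z) < d.
  rewrite -scalerBl -rmorphB rnormZ cmod_real.
  move: yt; rewrite ltr_pdivlMr ?ltr_wpDl ?rnorm_ge0 //; apply: le_lt_trans.
  by rewrite ler_wpM2l // lerDl.
have h2 : rnorm (t%:C *: z - t%:C *: z) < d by rewrite subrr rnorm0.
have step (a b : R) : rnorm (a%:C *: z - t%:C *: z) < d -> rnorm (b%:C *: z - t%:C *: z) < d ->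
    P a -> P b.
  move=> ha hb [H1 H2]; split=> A.
    have [B HB] := H1 A; have [B' HB'] := H B; exists B' => f Ff fA.
    by apply: (HB' f _ (a%:C *: z) Ff hb ha); exact: HB.
  have [B HB] := H A; have [B' HB'] := H2 B; exists B' => f Ff fA.
  by apply: (HB' f Ff); exact: (HB f _ (b%:C *: z) Ff ha hb).
by split; [exact: (step _ _ h1 h2)|exact: (step _ _ h2 h1)].
Qed.

(** What the limit argument consumes: the Lipschitz bound gives equicontinuity, the bounds at [z]
    give limits of values and of partial derivatives, and the Taylor bound gives holomorphy of the
    limit. *)
Lemma family_estimates (z : Cn) (A : R) : unit_ball z -> exists rho K : R,
  [/\ 0 < rho, 0 <= K, forall w, rnorm (w - z) < rho -> unit_ball w &
   forall f, F f -> cmod (f 0) <= A ->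
     [/\ forall w w', rnorm (w - z) < rho -> rnorm (w' - z) < rho ->
           cmod (f w' - f w) <= K * rnorm (w' - w),
         forall v, cmod ('D_v f z) <= K * rnorm v,
         cmod (f z) <= K &
         forall v, rnorm v < rho -> cmod (f (z + v) - f z - 'D_v f z) <= K * rnorm v ^+ 2]].
Proof.
move=> Dz; have [r [M [r0 M0 rD Fg _]]] := family_local_data Dz.
have [d d0 [dD Fd]] := family_comparison Dz.
have [B1 HB1] := (family_comparison0 A Dz).1.
have [B HB] := Fd B1.
pose rho := Num.min r d / 2.
have rho0 : 0 < rho by rewrite divr_gt0 // lt_min r0.
have r2 : rho *+ 2 = Num.min r d by rewrite -mulr_natr divfK.
pose K1 := M * (1 + `|B| `^ s).
have K10 : 0 <= K1 by rewrite mulr_ge0 // addr_ge0 // powR_ge0.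
have K2 : 0 <= 4 * K1 / rho.
  by apply: divr_ge0; [apply: mulr_ge0|apply: ltW].
exists rho, (K1 + `|B| + 4 * K1 / rho); split => //.
- by rewrite !addr_ge0.
- move=> w wr; apply: dD; apply: (lt_trans wr).
  by apply: (@lt_le_trans _ _ (rho *+ 2)); [rewrite mulr2n ltrDl|rewrite r2 ge_min lexx orbT].
move=> f Ff fA.
have zz : rnorm (z - z) < d by rewrite subrr rnorm0.
have fb w : rnorm (w - z) < rho *+ 2 ->
  [/\ forall v, derivable f w v, cmod (f w) <= `|B| & forall v, cmod ('D_v f w) <= K1 * rnorm v].
  rewrite r2 lt_min => /andP[wr wd].
  have fwB : cmod (f w) <= `|B|.
    by apply: le_trans (ler_norm _); apply: (HB f w z) => //; exact: HB1.
  have [df gf] := Fg f Ff w wr.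
  split; [exact: df|exact: fwB|move=> v].
  apply: (le_trans (gf v)); rewrite /K1 mulrAC ler_wpM2r ?rnorm_ge0 // ler_wpM2l // lerD2l.
  by apply: ge0_ler_powR; rewrite ?nnegrE ?cmod_ge0 // ltW.
have zr : rnorm (z - z) < rho by rewrite subrr rnorm0.
have zr2 : rnorm (z - z) < rho *+ 2 by rewrite subrr rnorm0 mulrn_wgt0.
have rr2 w : rnorm (w - z) < rho -> rnorm (w - z) < rho *+ 2.
  by move=> /lt_trans; apply; rewrite mulr2n ltrDl.
have le1 : K1 <= K1 + `|B| + 4 * K1 / rho by rewrite -addrA lerDl addr_ge0.
split.
- move=> w w' wr wr'; apply: (le_trans (ball_lipschitz fb (rr2 _ wr) (rr2 _ wr'))).
  by rewrite ler_wpM2r ?rnorm_ge0.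
- move=> v; have [_ _ Kv] := fb z zr2; apply: (le_trans (Kv v)).
  by rewrite ler_wpM2r ?rnorm_ge0.
- have [_ fzB _] := fb z zr2; apply: (le_trans fzB).
  by rewrite [K1 + _]addrC -addrA lerDl addr_ge0.
- move=> v vr; apply: (le_trans (ball_taylor rho0 fb zr _ K10)).
    by rewrite addrAC subrr add0r.
  by rewrite ler_wpM2r ?exprn_ge0 ?rnorm_ge0 // lerDr addr_ge0.
Qed.

End Family.

(** * Limits along an ultrafilter *)

Section Limits.
Context {R : realType} {n : nat}.
Local Notation C := R[i].
Local Notation Cn := 'rV[R[i]]_n.

Lemma compact_rectangle (r : R) : compact [set z : C |
  -r <= complex.Re z <= r /\ -r <= complex.Im z <= r].
Proof.
rewrite (_ : [set z | _] = (fun p : R * R => (p.1 +i* p.2 : C)) @`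
  (`[-r, r]%classic `*` `[-r, r]%classic)).
  apply: continuous_compact; first by apply: continuous_subspaceT; exact: continuous_ReIm.
  by apply: compact_setX; exact: segment_compact.
apply/seteqP; split => [z [h1 h2]|_ [[x y] [h1 h2] <-]] /=.
  by exists (complex.Re z, complex.Im z); [split; rewrite /= in_itv|case: z {h1 h2}].
by move: h1 h2; rewrite /= !in_itv.
Qed.

(** Compactness yields a cluster point. For an ultrafilter it is a limit: otherwise the set of [k]
    with [a k] at distance at least [e] from [l] would belong to [G], contradicting clustering. *)
Lemma ultrafilter_bounded_cvg (G : set_system nat) (a : nat -> C) (B : R) : UltraFilter G ->
  G [set k | cmod (a k) <= B] ->
  exists l : C, forall e : R, 0 < e -> G [set k | cmod (a k - l) < e].
Proof.
move=> UG aB.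
have PG : ProperFilter (a @ G) by exact: fmap_proper_filter.
have GA : G [set k | - B <= complex.Re (a k) <= B /\ - B <= complex.Im (a k) <= B].
  apply: filterS aB => k /= ak; split.
    by have := le_trans (normRe_le_cmod (a k)) ak; rewrite ler_norml.
  by have := le_trans (normIm_le_cmod (a k)) ak; rewrite ler_norml.
have [l [_ cl]] := @compact_rectangle B _ PG GA.
exists l => e e0.
have [//|Gn] := in_ultra_setVsetC [set k | cmod (a k - l) < e] UG.
have Nl : nbhs l [set z | cmod (z - l) < e] by apply/nbhs_rnormP; exists e.
have [_ [[k Hk <-] /= h]] : ((a @` ~` [set k | cmod (a k - l) < e]) `&` [set z | cmod (z - l) < e]) !=set0.
  have Ga : G [set k | (a @` ~` [set k | cmod (a k - l) < e]) (a k)].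
    by apply: filterS Gn => k Hk; exists k.
  exact: cl Ga Nl.
by case: (Hk h).
Qed.

Lemma uniform_cvg_cmod (U : set Cn) (v : nat -> Cn -> C) (g : Cn -> C) :
  (forall e : R, 0 < e -> \forall k \near \oo, forall w, U w -> cmod (v k w - g w) < e) ->
  {uniform U, v @ \oo --> g}.
Proof.
move=> H P /uniform_nbhs[E [entE EP]].
have [e /= e0 Ee] : exists2 e : C, 0 < e & [set xy | ball xy.1 e xy.2] `<=` E.
  by move: entE; rewrite -entourage_ballE => -[e e0 Ee]; exists e.
have re0 : 0 < complex.Re e by move: e0; rewrite ltcE => /andP[].
have ie0 : complex.Im e = 0 by move: e0; rewrite ltcE => /andP[/eqP].
apply: filterS (H _ re0) => k Hk; apply: EP => w Uw; apply: Ee => /=.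
by rewrite -ball_normE /= norm_cmod ltcE /= ie0 eqxx /= cmodB Hk.
Qed.

(** The differential is [0]; the lemma is applied after the candidate linear part has been
    subtracted. *)
Lemma differentiable_quadratic (f : Cn -> C) (z : Cn) (rho K : R) : 0 < rho -> 0 <= K ->
  (forall v, rnorm v < rho -> cmod (f (z + v) - f z) <= K * rnorm v ^+ 2) -> differentiable f z.
Proof.
move=> rho0 K0 H.
have E : f \o shift z = cst (f z) + \0 +o_ (0 : Cn) id.
  apply/eqaddoP => e; rewrite ltcE => /andP[/eqP /= e1 e2].
  apply/nbhs_rnormP; exists (Num.min rho (complex.Re e / (K + 1))).
    by rewrite lt_min rho0 divr_gt0 // ltr_wpDl.
  move=> v; rewrite subr0 lt_min => /andP[v1 v2].
  have -> : (f \o shift z - (cst (f z) + \0)) v = f (z + v) - f z.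
    by rewrite /= !fctE /= addr0 addrC [v + z]addrC addrC.
  rewrite norm_cmod rnormE (_ : e = (complex.Re e)%:C); last by case: e e1 {e2 v2} => x y /= ->.
  rewrite -rmorphM lecR (le_trans (H v v1)) // expr2 mulrA ler_wpM2r ?rnorm_ge0 //.
  move: v2; rewrite ltr_pdivlMr ?ltr_wpDl // mulrC => /ltW; apply: le_trans.
  by rewrite ler_wpM2r ?rnorm_ge0 // lerDl.
have c0 : continuous (\0 : Cn -> C) by exact: cst_continuous.
apply/diff_locallyP; rewrite (diff_unique c0 E).
by split.
Qed.

End Limits.

(** * A compact exhaustion of the ball *)

Section Exhaustion.
Context {R : realType} {n : nat}.
Local Notation C := R[i].
Local Notation Cn := 'rV[R[i]]_n.

Lemma continuous_sum_sqr : continuous (fun w : Cn => \sum_(i < n) cmod (w 0 i) ^+ 2).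
Proof.
have -> : (fun w : Cn => \sum_(i < n) cmod (w 0 i) ^+ 2) =
    \sum_(i < n) (fun w : Cn => cmod (w 0 i) * cmod (w 0 i)).
  by apply/funext => w; rewrite fct_sumE; apply: eq_bigr => i _; rewrite expr2.
move=> w; elim/big_ind : _ => [|f g cf cg|i _].
- exact: cst_continuous.
- exact: continuousD.
- have c : {for w, continuous (fun w : Cn => cmod (w 0 i))}.
    by apply: cmod_continuous; exact: coord_continuous.
  exact: (continuousM c c).
Qed.

(** Stated with the sum of squares, as in [unit_ballE], so that closedness follows from continuity
    of that sum. *)
Definition exhaustion (j : nat) : set Cn :=
  [set w | \sum_(i < n) cmod (w 0 i) ^+ 2 <= 1 - j.+1%:R^-1].

Lemma exhaustion_sub j : exhaustion j `<=` unit_ball.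
Proof.
by move=> w h; apply/unit_ballE; apply: (le_lt_trans h); rewrite ltrBlDr ltrDl invr_gt0 ltr0n.
Qed.

Lemma exhaustion_compact j : compact (exhaustion j).
Proof.
have [K [cK HK _]] := compact_polyrectangle (0 : Cn) (ler0n R 2).
apply: (subclosed_compact _ cK).
  rewrite (_ : exhaustion j = (fun w : Cn => \sum_(i < n) cmod (w 0 i) ^+ 2) @^-1`
    [set x | x <= 1 - j.+1%:R^-1]) //.
  by apply: closed_comp; [move=> w _; exact: continuous_sum_sqr|exact: closed_le].
move=> w /exhaustion_sub/unit_ballE h; apply: HK; rewrite subr0.
apply: (@le_lt_trans _ _ 1); last by rewrite ltr1n.
apply: rnorm_le_coord => // i.
rewrite -(@ler_pXn2r _ 2) ?nnegrE ?cmod_ge0 // expr1n (le_trans _ (ltW h)) //.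
by rewrite (bigD1 i) //= lerDl sumr_ge0 // => k _; exact: sqr_ge0.
Qed.

Lemma exhaustion_nbhs z : unit_ball z ->
  exists2 j, nbhs z (exhaustion j) & forall k, (j <= k)%N -> exhaustion j `<=` exhaustion k.
Proof.
move=> /unit_ballE; set S := \sum_(i < n) _ => S1.
have d0 : 0 < 1 - S by rewrite subr_gt0.
have d20 : 0 < (1 - S) / 2 by rewrite divr_gt0.
have [j hj] : exists j : nat, j.+1%:R^-1 <= (1 - S) / 2.
  exists (Num.bound ((1 - S) / 2)^-1).
  rewrite invf_ple ?posrE // (le_trans (ltW (archi_boundP _))) ?ler_nat //.
  by rewrite invr_ge0 ltW.
exists j.
  have /cvgrPdist_lt/(_ _ d20) := continuous_sum_sqr (x := z); apply: filterS => w.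
  rewrite -/S ltr_norml => /andP[h _]; rewrite /exhaustion /=.
  move: h hj; move: (\sum_(i < n) _) (j.+1%:R^-1) => a b; lra.
move=> k jk w; rewrite /exhaustion /= => /le_trans; apply.
by rewrite lerD2l lerN2 lef_pV2 ?posrE // ler_nat ltnS.
Qed.

End Exhaustion.

(** * The ultralimit: convergence on compact sets and holomorphy *)

Section UltraLimit.
Context {R : realType} {n : nat}.
Local Notation C := R[i].
Local Notation Cn := 'rV[R[i]]_n.
Variable G : set_system nat.
Hypothesis UG : UltraFilter G.

Definition ulim (a : nat -> C) (l : C) := forall e : R, 0 < e -> G [set k | cmod (a k - l) < e].

Lemma ulim_le (a : nat -> C) (l : C) (b : R) : ulim a l -> G [set k | cmod (a k) <= b] ->
  cmod l <= b.
Proof.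
move=> al ab; apply/ler_addgt0Pr => e e0.
have [k [h1 h2]] : ([set k | cmod (a k) <= b] `&` [set k | cmod (a k - l) < e]) !=set0.
  exact: (filter_ex (filterI ab (al _ e0))).
rewrite -[l](subrK (a k)) addrC (le_trans (cmodD _ _)) // lerD // cmodB.
exact: ltW.
Qed.

Lemma ulimD a b l m : ulim a l -> ulim b m -> ulim (a + b) (l + m).
Proof.
move=> al bm e e0; have e20 : 0 < e / 2 by rewrite divr_gt0.
apply: filterS (filterI (al _ e20) (bm _ e20)) => k [h1 h2] /=.
rewrite fctE opprD addrACA (le_lt_trans (cmodD _ _)) // [e]splitr ltrD //.
Qed.

Lemma ulimM c a l : ulim a l -> ulim (fun k => c * a k) (c * l).
Proof.
move=> al e e0; have d0 : 0 < cmod c + 1 by rewrite ltr_wpDl ?cmod_ge0.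
have ed : 0 < e / (cmod c + 1) by rewrite divr_gt0.
apply: filterS (al _ ed) => k /=; rewrite ltr_pdivlMr // -mulrBr cmodM; apply: le_lt_trans.
by rewrite mulrC ler_wpM2l ?cmod_ge0 // lerDl.
Qed.

Lemma ulimB a b l m : ulim a l -> ulim b m -> ulim (fun k => a k - b k) (l - m).
Proof.
move=> al bm; have := ulimD al (ulimM (-1) bm); rewrite mulN1r.
suff -> : a + (fun k => -1 * b k) = (fun k => a k - b k) by [].
by apply/funext => k; rewrite fctE mulN1r.
Qed.

Lemma ulim_sum (a : 'I_n -> nat -> C) (l : 'I_n -> C) : (forall i, ulim (a i) (l i)) ->
  ulim (fun k => \sum_i a i k) (\sum_i l i).
Proof.
move=> al; have -> : (fun k => \sum_i a i k) = \sum_i a i.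
  by apply/funext => k; rewrite fct_sumE.
elim/big_ind2 : _ => // [e e0|]; last by move=> *; exact: ulimD.
by apply: filterS filterT => k _ /=; rewrite subrr cmod0.
Qed.

Variables (u : nat -> Cn -> C) (A : R) (F : set (Cn -> C)).
Hypothesis Fu : forall k, F (u k).
Hypothesis hF : forall f, F f -> holomorphic unit_ball f.
Hypothesis GA : G [set k | cmod (u k 0) <= A].
Hypothesis est : forall z, unit_ball z -> exists rho K : R,
  [/\ 0 < rho, 0 <= K, forall w, rnorm (w - z) < rho -> unit_ball w &
   forall f, F f -> cmod (f 0) <= A ->
     [/\ forall w w', rnorm (w - z) < rho -> rnorm (w' - z) < rho ->
           cmod (f w' - f w) <= K * rnorm (w' - w),
         forall v, cmod ('D_v f z) <= K * rnorm v,
         cmod (f z) <= K &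
         forall v, rnorm v < rho -> cmod (f (z + v) - f z - 'D_v f z) <= K * rnorm v ^+ 2]].

Lemma ulim_exists : exists g : Cn -> C, forall z, unit_ball z -> ulim (u ^~ z) (g z).
Proof.
suff H z : exists l, unit_ball z -> ulim (u ^~ z) l.
  by have [g Hg] := choice H; exists g.
have [Dz|nD] := pselect (unit_ball z); last by exists 0.
have [rho [K [_ _ _ H]]] := est Dz.
have [|l Hl] := @ultrafilter_bounded_cvg R G (u ^~ z) K UG; last by exists l.
by apply: filterS GA => k /= /(H _ (Fu k))[].
Qed.

Variable g : Cn -> C.
Hypothesis ug : forall z, unit_ball z -> ulim (u ^~ z) (g z).

(** Pointwise convergence and equicontinuity give uniform convergence on compact sets. The
    near-covering form of compactness is used with [G] as parameter filter, in place of a finite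
    subcover. *)
Lemma ulim_compact (K : set Cn) (e : R) : compact K -> K `<=` unit_ball -> 0 < e ->
  G [set k | forall w, K w -> cmod (u k w - g w) < e].
Proof.
move=> /compact_near_coveringP cK KD e0.
have FG : Filter G by exact: filter_filter.
apply: (cK _ G (fun k w => cmod (u k w - g w) < e) FG) => z Kz.
have Dz := KD _ Kz; have [rho [L [rho0 L0 rhoD H]]] := est Dz.
have z0 : rnorm (z - z) < rho by rewrite subrr rnorm0.
have L1 : 0 < 4 * L + 1 by rewrite ltr_wpDl // mulr_ge0.
have glip w : rnorm (w - z) < rho -> cmod (g w - g z) <= L * rnorm (w - z).
  move=> wr; apply: (ulim_le (ulimB (ug (rhoD _ wr)) (ug Dz))).
  by apply: filterS GA => k /= /(H _ (Fu k))[lip _ _ _]; exact: lip.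
(* The Lipschitz bounds for [u k] and for [g] cost [L |w - z|] each, together less than [e / 2]; the
   other half is the error at [z]. *)
pose d := Num.min rho (e / (4 * L + 1)).
have d0 : 0 < d by rewrite lt_min rho0 divr_gt0.
have e20 : 0 < e / 2 by rewrite divr_gt0.
exists ([set w | rnorm (w - z) < d], [set k | cmod (u k 0) <= A] `&` [set k | cmod (u k z - g z) < e / 2]).
  split => /=; first by apply/nbhs_rnormP; exists d.
  by apply: filterI => //; exact: ug.
move=> [w k] [/= wd [kA kz]]; have [lip _ _ _] := H _ (Fu k) kA.
move: wd; rewrite lt_min => /andP[wr]; rewrite ltr_pdivlMr // => we.
have -> : u k w - g w = (u k w - u k z) + (u k z - g z) + (g z - g w) by ring.
have h1 := lip _ _ z0 wr; have h2 := glip w wr; rewrite cmodB in h2.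
apply: (le_lt_trans (cmodD _ _)); apply: (le_lt_trans (lerD (cmodD _ _) (lexx _))).
apply: (le_lt_trans (lerD (lerD h1 (ltW kz)) h2)).
have := rnorm_ge0 (w - z); have : 0 <= L * rnorm (w - z) by rewrite mulr_ge0 ?rnorm_ge0.
move: (rnorm (w - z)) we => x we; nra.
Qed.

(** The Taylor bound has a constant independent of [k], so it passes to the limit, with the
    ultralimits [a i] of the partial derivatives as coefficients of the linear part. *)
Lemma ulim_holomorphic : holomorphic unit_ball g.
Proof.
move=> z Dz; have [rho [K [rho0 K0 rhoD H]]] := est Dz.
have [a Ha] : exists a : 'I_n -> C, forall i, ulim (fun k => cgrad (u k) z 0 i) (a i).
  suff H' i : exists l, ulim (fun k => cgrad (u k) z 0 i) l.
    by have [a Ha] := choice H'; exists a.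
  have [|l Hl] := @ultrafilter_bounded_cvg R G (fun k => cgrad (u k) z 0 i)
    (K * rnorm (delta_mx 0 i : Cn)) UG; last by exists l.
  by apply: filterS GA => k /= /(H _ (Fu k))[_ Dk _ _]; rewrite mxE; exact: Dk.
pose h (w : Cn) := \sum_i (w 0 i - z 0 i) * a i.
have dh w : differentiable h w.
  have -> : h = \sum_i (a i \*: ((fun y : Cn => y 0 i) - cst (z 0 i))).
    apply/funext => y; rewrite /h fct_sumE; apply: eq_bigr => i _.
    by rewrite mulrC.
  apply: differentiable_sum => i; apply: differentiableZ; apply: differentiableB.
    exact: differentiable_coord.
  exact: differentiable_cst.
have -> : g = (g - h) + h by rewrite subrK.
apply: differentiableD; last exact: dh.
apply: (@differentiable_quadratic _ _ _ _ rho K) => // v vr.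
have Dzv : unit_ball (z + v) by apply: rhoD; rewrite addrAC subrr add0r.
have -> : (g - h) (z + v) - (g - h) z = g (z + v) - g z - \sum_i v 0 i * a i.
  have -> : (g - h) (z + v) = g (z + v) - \sum_i v 0 i * a i.
    rewrite !fctE /h; congr (_ - _); apply: eq_bigr => i _.
    by rewrite mxE addrAC subrr add0r.
  have -> : (g - h) z = g z.
    by rewrite !fctE /h big1 ?subr0 // => i _; rewrite subrr mul0r.
  by rewrite addrAC.
apply: (ulim_le (ulimB (ulimB (ug Dzv) (ug Dz)) (ulim_sum (fun i => ulimM (v 0 i) (Ha i))))).
apply: filterS GA => k /= /(H _ (Fu k))[_ _ _ Tk]; rewrite -derive_coord; last exact: hF.
exact: Tk.
Qed.

End UltraLimit.

Unset Implicit Arguments.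
Set Strict Implicit.
Set Printing Implicit Defensive.

Theorem theorem2p7 (R : realType) (n : nat) (hn : (0 < n)%N)
    (F : set ('rV[R[i]]_n -> R[i])) (s : R) (hs : 0 < s)
    (hF : forall f, F f -> holomorphic unit_ball f)
    (hG : locally_uniformly_bounded unit_ball
      [set (fun z => enorm (cgrad f z) / (1 + cmod (f z) `^ s)) | f in F]) :
  normal_family unit_ball F.
Proof.
move=> u Fu.
have [div|] := pselect (forall A, \forall k \near \oo, A < cmod (u k 0)).
  exists id => //; right => z Dz; have [d d0 [_ Hd]] := family_comparison hs hF hG Dz.
  exists [set w | rnorm (w - z) < d]; first by apply/nbhs_rnormP; exists d.
  (* If [|u k w| <= A] at some [w] near [z], then [|u k z| <= B] and hence [|u k 0| <= B'], which
     fails for large [k]. *)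
  move=> A; have [B HB] := Hd A; have [B' HB'] := (family_comparison0 hs hF hG B Dz).2.
  apply: filterS (div B') => k hk w [wd _] /=; rewrite ltNge; apply/negP => uA.
  have zd : rnorm (z - z) < d by rewrite subrr rnorm0.
  by move: hk; rewrite ltNge (HB' _ (Fu k)) // (HB _ z w (Fu k)).
move=> /existsNP[A nA].
pose S := [set k | cmod (u k 0) <= A].
(* [S] is infinite, so [\oo] restricted to [S] is proper. An ultrafilter refining it contains [S]
   and still every cofinite set, so indices can always be chosen beyond a given one. *)
have PW : ProperFilter (within S \oo).
  have FW : Filter (within S \oo) by exact: within_filter.
  suff nW : ~ within S \oo set0 by exact: (Build_ProperFilter nW FW).
  rewrite /within => W0; apply: nA; apply: (@filterS _ \oo _ _ _ _ W0) => k /= kS.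
  by rewrite ltNge; apply/negP.
have [G [UG WG]] := ultraFilterLemma PW.
have GS : G S by apply: WG; exact: nearW.
have Goo P : (\forall k \near \oo, P k) -> G [set k | P k].
  by move=> hP; apply: WG; exact: cvg_within hP.
have est z Dz := family_estimates hs hF hG A (z := z) Dz.
have [g ug] := ulim_exists UG Fu GS est.
have cvgj (j : nat) : G [set k | forall w, exhaustion j w -> cmod (u k w - g w) < j.+1%:R^-1].
  apply: (ulim_compact UG Fu GS est ug); first exact: exhaustion_compact.
    exact: exhaustion_sub.
  by rewrite invr_gt0.
have next (jN : nat * nat) : exists k, (jN.2 < k)%N /\
    forall w, exhaustion jN.1 w -> cmod (u k w - g w) < jN.1.+1%:R^-1.
  have [k [h1 h2]] := filter_ex (filterI (Goo _ (nbhs_infty_gt jN.2)) (cvgj jN.1)).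
  by exists k.
have [p Hp] := choice next.
(* [phi j] is picked at stage [j] beyond the previous index; the initial pair [(0, 0)] means stage
   [0] with bound [0] on the index. *)
pose phi := fix phi j := if j is j'.+1 then p (j, phi j') else p (0, 0).
exists phi.
  by apply: homo_ltn; [exact: ltn_trans|move=> j; exact: (Hp (j.+1, phi j)).1].
have phiE j w : exhaustion j w -> cmod (u (phi j) w - g w) < j.+1%:R^-1.
  by case: j => [|j]; [exact: (Hp (0, 0)).2|exact: (Hp (j.+1, phi j)).2].
left; exists g; first exact: (ulim_holomorphic UG Fu hF GS est ug).
move=> z Dz; have [j0 Nz Hj] := exhaustion_nbhs Dz.
exists (exhaustion j0) => //; apply: uniform_cvg_cmod => e e0.
(* The exhaustion increases, so for [k >= j0] the error of stage [k] is controlled on the fixed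
   neighbourhood [exhaustion j0]. *)
near=> k => w [wj _]; apply: (@lt_trans _ _ k.+1%:R^-1).
  by apply: phiE; apply: Hj wj; near: k; exact: nbhs_infty_ge.
near: k; exact: (near_infty_natSinv_lt (PosNum e0)).
Unshelve. all: by end_near.
Qed.
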